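(* Let $k$ be an arbitrary field and let $H$ be a finite-dimensional cocommutative Hopf algebra over $k$. Then $H$ is local if and only if the subalgebra of $H$ generated by $H_1$ is local.
   Context: For a Hopf algebra $H$ with counit $\varepsilon$ and comultiplication $\Delta$: the coradical $H_0$ is the sum of all simple subcoalgebras of $H$, and for $n\ge 1$ one sets inductively $H_n=\Delta^{-1}(H\otimes H_{n-1}+H_0\otimes H)$; the chain $H_0\subseteq H_1\subseteq\cdots$ is the coradical filtration. An algebra is local if it has a unique maximal one-sided ideal. *)

(* Defs.v *)
(* Finite-dimensional Hopf algebras over a field, encoded on
   top of mathcomp's [falgType K] (finite-dimensional unital K-algebras).
   Tensors in H (x) H are encoded as d x d matrices of coordinates w.r.t. the
   fixed basis [hb] of H (d = dim H): the matrix M stands for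
   \sum_(i,j) M i j  hb i (x) hb j. *)
From HB Require Import structures.
From mathcomp Require Import all_boot all_order all_algebra all_field.
Set Implicit Arguments.
Unset Strict Implicit.
Unset Printing Implicit Defensive.
Import GRing.Theory.
Local Open Scope ring_scope.

Section Hopf.
Variables (K : fieldType) (H : falgType K).

Local Notation d := (\dim (fullv : {vspace H})).

Definition hbasis : d.-tuple H := vbasis fullv.
Definition hb (i : 'I_d) : H := tnth hbasis i.
Definition hco (i : 'I_d) (x : H) : K := coord hbasis i x.

Definition tens (x y : H) : 'M[K]_(d, d) := \matrix_(i, j) (hco i x * hco j y).

Definition tmul (M N : 'M[K]_(d, d)) : 'M[K]_(d, d) :=
  \sum_(i < d) \sum_(j < d) \sum_(i' < d) \sum_(j' < d)
     (M i j * N i' j') *: tens (hb i * hb i') (hb j * hb j').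

Definition tensv (U V : {vspace H}) : {vspace 'M[K]_(d, d)} :=
  <<[seq tens u v | u <- vbasis U, v <- vbasis V]>>%VS.

Definition is_hopf (D : 'Hom(H, 'M[K]_(d, d))) (e : 'Hom(H, K^o)) (S : 'End(H))
  : Prop :=
  [/\ (* coassociativity: (D (x) id) D x = (id (x) D) D x, coefficientwise
         at hb a (x) hb b (x) hb c *)
      forall (x : H) (a b c : 'I_d),
        \sum_(i < d) D x i c * D (hb i) a b = \sum_(j < d) D x a j * D (hb j) b c,
      forall x : H,
        \sum_(i < d) \sum_(j < d) (D x i j * e (hb i)) *: hb j = x /\
        \sum_(i < d) \sum_(j < d) (D x i j * e (hb j)) *: hb i = x,
      D 1 = tens 1 1 /\ (forall x y : H, D (x * y) = tmul (D x) (D y)),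
      e 1 = 1 /\ (forall x y : H, e (x * y) = e x * e y)
    &
      forall x : H,
        \sum_(i < d) \sum_(j < d) D x i j *: (S (hb i) * hb j) = e x *: 1 /\
        \sum_(i < d) \sum_(j < d) D x i j *: (hb i * S (hb j)) = e x *: 1 ].

Definition cocommutative (D : 'Hom(H, 'M[K]_(d, d))) : Prop :=
  forall x : H, (D x)^T = D x.

Definition subcoalgebra (D : 'Hom(H, 'M[K]_(d, d))) (C : {vspace H}) : Prop :=
  forall x, x \in C -> D x \in tensv C C.

Definition simple_subcoalgebra (D : 'Hom(H, 'M[K]_(d, d))) (C : {vspace H})
  : Prop :=
  [/\ subcoalgebra D C, C != 0%VS &
      forall C' : {vspace H}, subcoalgebra D C' -> (C' <= C)%VS ->
        C' = 0%VS \/ C' = C].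

(* V is the sum (= least upper bound among subspaces) of all simple
   subcoalgebras of H *)
Definition is_coradical (D : 'Hom(H, 'M[K]_(d, d))) (V : {vspace H}) : Prop :=
  (forall C, simple_subcoalgebra D C -> (C <= V)%VS) /\
  (forall W : {vspace H},
      (forall C, simple_subcoalgebra D C -> (C <= W)%VS) -> (V <= W)%VS).

Definition coradical_step (D : 'Hom(H, 'M[K]_(d, d))) (H0 : {vspace H})
  : {vspace H} :=
  (D @^-1: (tensv fullv H0 + tensv H0 fullv))%VS.

(* local algebras: for a subalgebra A of H containing 1 (left ideals of A
   are then automatically K-subspaces) *)
Definition left_ideal (A I : {vspace H}) : Prop :=
  (I <= A)%VS /\ (A * I <= I)%VS.

Definition maximal_left_ideal (A I : {vspace H}) : Prop :=
  [/\ left_ideal A I, I != A &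
      forall J : {vspace H}, left_ideal A J -> J != A -> (I <= J)%VS -> J = I].

Definition is_local (A : {vspace H}) : Prop :=
  exists! I : {vspace H}, maximal_left_ideal A I.

End Hopf.

(* Main.v *)
Require Import Defs.
From HB Require Import structures.
From Stdlib Require Import Classical.
From mathcomp Require Import all_boot all_order all_algebra all_field ring.
Set Implicit Arguments.
Unset Strict Implicit.
Unset Printing Implicit Defensive.
Import GRing.Theory.
Local Open Scope ring_scope.

(** Let B = H^* be the dual algebra, which is commutative because H is cocommutative,
    with augmentation ideal m, and put A = k<H_1> and H^+ = ker e. Locality of a
    subalgebra amounts to nilpotency of its augmentation ideal, so one implication is
    clear. Conversely the annihilator of A is contained in N^2, where N = H_0^perp
    consists of nilpotent elements.

    If dim H is nonzero in k, the radical of the trace form of B is a translation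
    invariant ideal not containing 1, hence is 0; so B is reduced, N = 0 and A = H.

    Otherwise k has characteristic p. Let B_q be the span of the q-th powers of B, with
    q = p^r, and A_q the annihilator in H of the q-th powers of A^perp: a Frobenius twist
    of A, which again acts unipotently on B_q. The A_q-invariants D of B_q satisfy
    D^+ <= m_q^2 (m_q the augmentation ideal of B_q) and are stable under the invariant
    derivations, so D^+ lies in the ideal generated by the augmentation ideal of B_pq.
    A socle element t of B_pq then satisfies t D <= B_pq, and the set of c in B_pq with
    c D <= B_pq is a nonzero translation invariant ideal of the Hopf algebra B_pq; it
    contains 1, that is D <= B_pq. Hence a nonzero translation invariant V <= B meets
    every B_q. For large q the algebra B_q is reduced, A_q contains H^+, and so
    V contains 1. Taking V = U^perp, every proper left ideal U of H lies in H^+. *)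

(** * The dual algebra of a cocommutative coalgebra *)

(* A cocommutative coalgebra on a basis indexed by T: [cog x a b] is the coefficient of
   a (x) b in the comultiplication of x. *)
Record cocoalg (K : fieldType) (T : finType) := Cocoalg {
  cog : T -> T -> T -> K;
  cou : T -> K;
  cogA : forall x a b c,
    \sum_i cog x i c * cog i a b = \sum_j cog x a j * cog j b c;
  cogC : forall x a b, cog x a b = cog x b a;
  cog_cou : forall x j, \sum_i cog x i j * cou i = (x == j)%:R;
  cou_neq0 : exists x, cou x != 0 }.

(** The argument C lets each coalgebra put its own convolution product, as canonical ring structure,
    on this type of functions. *)
Definition cdual (K : fieldType) (T : finType) (C : cocoalg K T) :=
  {ffun T -> K^o}.

Section CoalgebraDual.
Variables (K : fieldType) (T : finType) (C : cocoalg K T).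
Implicit Types f g h : cdual C.

HB.instance Definition _ := Vector.on (cdual C).

Definition cmul f g : cdual C :=
  [ffun x => \sum_a \sum_b cog C x a b * ((f a : K) * g b)].

Definition cone : cdual C := [ffun x => cou C x].

Fact cmulA : associative cmul.
Proof.
move=> f g h; apply/ffunP=> x; rewrite !ffunE.
transitivity (\sum_a \sum_b \sum_c
   (\sum_j cog C x a j * cog C j b c) * (f a * g b * h c)).
  apply: eq_bigr => a _; under eq_bigr => j _ do rewrite ffunE !mulr_sumr.
  rewrite exchange_big; apply: eq_bigr => b _ /=.
  under eq_bigr => j _ do rewrite !mulr_sumr.
  rewrite exchange_big; apply: eq_bigr => c _ /=.
  by rewrite mulr_suml; apply: eq_bigr => j _; rewrite !mulrA (mulrAC _ (f a)).
under eq_bigr => a _ do (under eq_bigr => b _ do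
  (under eq_bigr => c _ do rewrite -cogA mulr_suml)).
rewrite [RHS](eq_bigr (fun i => \sum_c \sum_a \sum_b
   cog C x i c * cog C i a b * (f a * g b * h c))); last first.
  move=> i _; apply: eq_bigr => c _; rewrite ffunE mulr_suml mulr_sumr.
  apply: eq_bigr => a _; rewrite mulr_suml mulr_sumr.
  by apply: eq_bigr => b _; rewrite !mulrA.
under [LHS]eq_bigr => a _ do under eq_bigr => b _ do rewrite exchange_big /=.
under [LHS]eq_bigr => a _ do rewrite exchange_big /=.
rewrite exchange_big; apply: eq_bigr => i _ /=.
under [LHS]eq_bigr => a _ do rewrite exchange_big /=.
by rewrite exchange_big.
Qed.

Fact cmulC : commutative cmul.
Proof.
move=> f g; apply/ffunP=> x; rewrite !ffunE exchange_big /=.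
by apply: eq_bigr => a _; apply: eq_bigr => b _; rewrite cogC [f b * _]mulrC.
Qed.

Fact cmul1 : left_id cone cmul.
Proof.
move=> f; apply/ffunP=> x; rewrite !ffunE exchange_big /=.
rewrite (bigD1 x) //= [X in _ + X]big1 ?addr0 => [|b neq_bx].
  under eq_bigr => a _ do rewrite ffunE mulrA.
  by rewrite -mulr_suml cog_cou eqxx mul1r.
under eq_bigr => a _ do rewrite ffunE mulrA.
by rewrite -mulr_suml cog_cou eq_sym (negPf neq_bx) mul0r.
Qed.

Fact cmulDl : left_distributive cmul +%R.
Proof.
move=> f g h; apply/ffunP=> x; rewrite !ffunE -big_split; apply: eq_bigr => a _.
by rewrite -big_split; apply: eq_bigr => b _; rewrite /= ffunE mulrDl mulrDr.
Qed.

Fact cone_neq0 : cone != 0.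
Proof.
by have [x nz] := cou_neq0 C; apply: contraNneq nz => /ffunP/(_ x); rewrite !ffunE => ->.
Qed.

HB.instance Definition _ := GRing.Zmodule_isComNzRing.Build (cdual C)
  cmulA cmulC cmul1 cmulDl cone_neq0.

Fact cscalerAl (k : K) f g : k *: (f * g) = (k *: f) * g.
Proof.
apply/ffunP=> x; rewrite !ffunE scaler_sumr; apply: eq_bigr => a _.
by rewrite scaler_sumr; apply: eq_bigr => b _; rewrite ffunE -[LHS]/(k * _) mulrCA !mulrA.
Qed.

HB.instance Definition _ := GRing.Lmodule_isLalgebra.Build K (cdual C) cscalerAl.
HB.instance Definition _ := GRing.Lalgebra_isComAlgebra.Build K (cdual C).
HB.instance Definition _ := Algebra_isFalgebra.Build K (cdual C).

Lemma cdualM f g x : (f * g) x = \sum_a \sum_b cog C x a b * ((f a : K) * g b).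
Proof. by rewrite -[LHS]/(cmul f g x) ffunE. Qed.

Lemma cdual1 x : (1 : cdual C) x = cou C x.
Proof. by rewrite -[LHS]/(cone x) ffunE. Qed.

End CoalgebraDual.

(** * Functionals on the Hopf algebra and their translates *)

Section HopfDual.
Variables (K : fieldType) (H : falgType K).
Local Notation d := (\dim (fullv : {vspace H})).
Variables (D : 'Hom(H, 'M[K]_(d, d))) (e : 'Hom(H, K^o)) (S : 'End(H)).
Hypotheses (hopfD : is_hopf D e S) (cocoD : cocommutative D).
Implicit Types (x y z : H) (i j k : 'I_d).
Local Notation h_ := (@hb K H).

Lemma hco_hb k j : hco k (h_ j) = (k == j)%:R.
Proof.
have: free (hbasis H) := basis_free (vbasisP _).
rewrite /hco /hb; move: (hbasis H) => X freeX.
by rewrite (tnth_nth 0) coord_free // eq_sym.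
Qed.

Lemma hb_expand x : x = \sum_k hco k x *: h_ k.
Proof.
have := coord_basis (vbasisP fullv) (memvf x); rewrite /hco /hb /hbasis.
move: (vbasis fullv) => X {1}->.
by apply: eq_bigr => k _; rewrite (tnth_nth 0).
Qed.

Lemma hco_sum k (I : finType) (a : I -> K) (u : I -> H) :
  hco k (\sum_i a i *: u i) = \sum_i a i * hco k (u i).
Proof. by rewrite /hco linear_sum; apply: eq_bigr => i _; rewrite linearZ. Qed.

Lemma comul_expand x i j : D x i j = \sum_k hco k x * D (h_ k) i j.
Proof.
rewrite {1}[x]hb_expand linear_sum summxE.
by apply: eq_bigr => k _; rewrite linearZ mxE.
Qed.

Lemma comul_sym x i j : D x i j = D x j i.
Proof. by rewrite -[in RHS](cocoD x) mxE. Qed.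

Lemma counit_coef x j : \sum_i D x i j * e (h_ i) = hco j x.
Proof.
have [_ /(_ x)[E _] _ _ _] := hopfD.
rewrite -[in RHS]E exchange_big /=.
under [in RHS]eq_bigr => k _ do rewrite -scaler_suml.
rewrite hco_sum [RHS](bigD1 j) //= hco_hb eqxx mulr1 [X in _ = _ + X]big1 ?addr0 // => k nkj.
by rewrite hco_hb eq_sym (negPf nkj) mulr0.
Qed.

(** Coassociativity in Sweedler form: the sum of F(x_1, x_2, x_3) may be bracketed either way. All
    convolution computations below use it with module-valued F. *)
Lemma coassoc (V : lmodType K) x (F : 'I_d -> 'I_d -> 'I_d -> V) :
  \sum_i \sum_c D x i c *: (\sum_a \sum_b D (h_ i) a b *: F a b c) =
  \sum_a \sum_j D x a j *: (\sum_b \sum_c D (h_ j) b c *: F a b c).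
Proof.
have [A _ _ _ _] := hopfD.
transitivity (\sum_a \sum_b \sum_c (\sum_i D x i c * D (h_ i) a b) *: F a b c).
  under eq_bigr => i _ do (under eq_bigr => c _ do
    (rewrite scaler_sumr; under eq_bigr => a _ do rewrite scaler_sumr);
    rewrite exchange_big; under eq_bigr => a _ do rewrite exchange_big).
  rewrite exchange_big; apply: eq_bigr => a _ /=.
  rewrite exchange_big; apply: eq_bigr => b _ /=.
  rewrite exchange_big; apply: eq_bigr => c _ /=.
  by rewrite scaler_suml; apply: eq_bigr => i _; rewrite scalerA.
apply: eq_bigr => a _.
under [RHS]eq_bigr => j _ do (rewrite scaler_sumr;
   under eq_bigr => b _ do rewrite scaler_sumr).
rewrite [RHS]exchange_big; apply: eq_bigr => b _ /=.
rewrite [RHS]exchange_big; apply: eq_bigr => c _ /=.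
by rewrite A scaler_suml; apply: eq_bigr => i _; rewrite scalerA.
Qed.

Fact hopf_cog_cou k j : \sum_i D (h_ k) i j * e (h_ i) = (k == j)%:R.
Proof. by rewrite counit_coef hco_hb eq_sym. Qed.

Fact hopf_cou_neq0 : exists k, e (h_ k) != 0.
Proof.
apply/existsP; apply: contraT; rewrite negb_exists => /forallP e0.
have [_ _ _ [e1 _] _] := hopfD.
suff: e 1 = 0 by rewrite e1 => /eqP; rewrite oner_eq0.
rewrite [1]hb_expand linear_sum big1 // => k _.
by rewrite linearZ /= (eqP (negbNE (e0 k))) scaler0.
Qed.

Definition hopf_cocoalg : cocoalg K 'I_d :=
  @Cocoalg K 'I_d (fun k i j => D (h_ k) i j) (fun k => e (h_ k))
    (fun k a b c => let: And5 A _ _ _ _ := hopfD in A (h_ k) a b c)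
    (fun k i j => comul_sym (h_ k) i j) hopf_cog_cou hopf_cou_neq0.

Local Notation B := (cdual hopf_cocoalg).
Implicit Types b c f g : B.

(* B is only definitionally a space of coordinate vectors; [ev] pairs it with H. *)
Definition ev b x : K := \sum_k hco k x * b k.

Lemma ev_hb b k : ev b (h_ k) = b k.
Proof.
rewrite /ev (bigD1 k) //= hco_hb eqxx mul1r big1 ?addr0 // => j /negPf njk.
by rewrite hco_hb njk mul0r.
Qed.

Lemma ev_inj b c : ev b =1 ev c -> b = c.
Proof. by move=> E; apply/ffunP=> k; rewrite -!ev_hb. Qed.

Fact evr_is_linear b : linear (ev b : H -> K^o).
Proof.
move=> a x y; rewrite /ev scaler_sumr -big_split; apply: eq_bigr => k _ /=.
by rewrite /hco linearP mulrDl -mulrA.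
Qed.

HB.instance Definition _ b :=
  GRing.isLinear.Build K H K^o _ (ev b) (evr_is_linear b).

Definition evl x b : K^o := ev b x.

Fact evl_is_linear x : linear (evl x).
Proof.
move=> a b c; rewrite /evl /ev scaler_sumr -big_split; apply: eq_bigr => k _ /=.
by rewrite !ffunE mulrDr; congr (_ + _); exact: mulrCA.
Qed.

HB.instance Definition _ x :=
  GRing.isLinear.Build K B K^o _ (evl x) (evl_is_linear x).

Lemma evlE x b : ev b x = evl x b. Proof. by []. Qed.

Lemma ev1l x : ev 1 x = e x.
Proof.
rewrite {2}[x]hb_expand linear_sum; apply: eq_bigr => k _.
by rewrite linearZ; congr (_ * _); apply: cdual1.
Qed.

Lemma counit1 : e 1 = 1. Proof. by have [_ _ _ []] := hopfD. Qed.
Lemma counitM x y : e (x * y) = e x * e y. Proof. by have [_ _ _ []] := hopfD. Qed.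

Lemma evM b c x : ev (b * c) x = \sum_i \sum_j D x i j * ((b i : K) * c j).
Proof.
rewrite /ev; under eq_bigr => k _ do rewrite cdualM mulr_sumr.
rewrite exchange_big; apply: eq_bigr => i _ /=.
under eq_bigr => k _ do rewrite mulr_sumr.
rewrite exchange_big; apply: eq_bigr => j _ /=.
by rewrite comul_expand mulr_suml; apply: eq_bigr => k _; rewrite mulrA.
Qed.

Lemma comul_one : D 1 = tens 1 1. Proof. by have [_ _ []] := hopfD. Qed.

Lemma ev_tens b c x y :
  \sum_i \sum_j tens x y i j * ((b i : K) * c j) = ev b x * ev c y.
Proof.
rewrite /ev mulr_suml; apply: eq_bigr => i _; rewrite mulr_sumr.
by apply: eq_bigr => j _; rewrite mxE mulrACA.
Qed.

Lemma evM1 b c : ev (b * c) 1 = ev b 1 * ev c 1.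
Proof. by rewrite evM comul_one ev_tens. Qed.

Lemma evMM b c x y : ev (b * c) (x * y) =
  \sum_i \sum_j D x i j * (\sum_i' \sum_j' D y i' j' *
     (ev b (h_ i * h_ i') * ev c (h_ j * h_ j'))).
Proof.
have [_ _ [_ /(_ x y) E] _ _] := hopfD.
(* [lin] is b (x) c as a functional on matrices; it is bundled as a linear map so that it passes
   through the sums of [tmul]. *)
pose lin (M : 'M[K]_(d, d)) : K^o := \sum_i \sum_j M i j * ((b i : K) * c j).
have linD a M N : lin (a *: M + N) = a *: lin M + lin N.
  rewrite /lin scaler_sumr -big_split; apply: eq_bigr => i _.
  rewrite scaler_sumr -big_split; apply: eq_bigr => j _.
  by rewrite !mxE mulrDl -mulrA.
pose L : {linear 'M[K]_(d, d) -> K^o} := HB.pack lin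
  (GRing.isLinear.Build K 'M[K]_(d, d) K^o _ lin linD).
rewrite evM E -[LHS]/(L _) /tmul !linear_sum; apply: eq_bigr => i _.
rewrite linear_sum; apply: eq_bigr => j _.
rewrite linear_sum mulr_sumr; apply: eq_bigr => i' _.
rewrite linear_sum mulr_sumr; apply: eq_bigr => j' _.
by rewrite linearZ /= /lin ev_tens mulrA.
Qed.

(** [rtrans] is a left action of H on B and [ltrans] a right action; the two commute. [antip] is the
    transpose of S. *)
Definition ltrans x b : B := [ffun k => ev b (x * h_ k)].
Definition rtrans x b : B := [ffun k => ev b (h_ k * x)].
Definition antip b : B := [ffun k => ev b (S (h_ k))].

Lemma ev_ltrans x b y : ev (ltrans x b) y = ev b (x * y).
Proof.
rewrite {2}[y]hb_expand mulr_sumr linear_sum; apply: eq_bigr => k _.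
by rewrite -scalerAr linearZ ffunE.
Qed.

Lemma ev_rtrans x b y : ev (rtrans x b) y = ev b (y * x).
Proof.
rewrite {2}[y]hb_expand mulr_suml linear_sum; apply: eq_bigr => k _.
by rewrite -scalerAl linearZ ffunE.
Qed.

Lemma ev_antip b y : ev (antip b) y = ev b (S y).
Proof.
rewrite {2}[y]hb_expand !linear_sum; apply: eq_bigr => k _.
by rewrite !linearZ ffunE.
Qed.

Fact ltrans_is_linear x : linear (ltrans x).
Proof. by move=> a b c; apply: ev_inj => y; rewrite ev_ltrans !evlE !linearP /= /evl !ev_ltrans. Qed.
HB.instance Definition _ x :=
  GRing.isLinear.Build K B B _ (ltrans x) (ltrans_is_linear x).

Fact rtrans_is_linear x : linear (rtrans x).
Proof. by move=> a b c; apply: ev_inj => y; rewrite ev_rtrans !evlE !linearP /= /evl !ev_rtrans. Qed.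
HB.instance Definition _ x :=
  GRing.isLinear.Build K B B _ (rtrans x) (rtrans_is_linear x).

Fact antip_is_linear : linear antip.
Proof. by move=> a b c; apply: ev_inj => y; rewrite ev_antip !evlE !linearP /= /evl !ev_antip. Qed.
HB.instance Definition _ :=
  GRing.isLinear.Build K B B _ antip antip_is_linear.

(** The orbit map of b; the antipode and counit identities are stated for linear maps on H and are
    applied to it. *)
Definition rtransl b x : B := rtrans x b.
Fact rtransl_is_linear b : linear (rtransl b).
Proof.
move=> a x y; apply: ev_inj => z.
by rewrite /rtransl ev_rtrans mulrDr -scalerAr linearP evlE linearP /= /evl !ev_rtrans.
Qed.
HB.instance Definition _ b :=
  GRing.isLinear.Build K H B _ (rtransl b) (rtransl_is_linear b).

Lemma rtrans_comp x y b : rtrans x (rtrans y b) = rtrans (x * y) b.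
Proof. by apply: ev_inj => z; rewrite !ev_rtrans mulrA. Qed.
Lemma ltrans_rtrans x y b : ltrans x (rtrans y b) = rtrans y (ltrans x b).
Proof. by apply: ev_inj => z; rewrite ev_ltrans !ev_rtrans ev_ltrans mulrA. Qed.
Lemma rtrans1 b : rtrans 1 b = b.
Proof. by apply: ev_inj => z; rewrite ev_rtrans mulr1. Qed.
Lemma ev_sum (I : finType) (a : I -> K) (u : I -> B) x :
  ev (\sum_i a i *: u i) x = \sum_i a i * ev (u i) x.
Proof. by rewrite evlE linear_sum; apply: eq_bigr => i _; rewrite linearZ. Qed.

Lemma ev_sum2 (a : 'I_d -> 'I_d -> K) (u : 'I_d -> 'I_d -> B) x :
  ev (\sum_i \sum_j a i j *: u i j) x = \sum_i \sum_j a i j * ev (u i j) x.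
Proof.
rewrite evlE linear_sum; apply: eq_bigr => i _; exact: ev_sum.
Qed.

Lemma ev_sumr b (I : finType) (a : I -> K) (u : I -> H) :
  ev b (\sum_i a i *: u i) = \sum_i a i * ev b (u i).
Proof. by rewrite linear_sum; apply: eq_bigr => i _; rewrite linearZ. Qed.
Lemma evPr b a x y : ev b (a *: x + y) = a * ev b x + ev b y.
Proof. exact: linearP. Qed.
Lemma evDr b x y : ev b (x + y) = ev b x + ev b y.
Proof. exact: linearD. Qed.
Lemma evBr b x y : ev b (x - y) = ev b x - ev b y.
Proof. exact: linearB. Qed.
Lemma evZr b a x : ev b (a *: x) = a * ev b x.
Proof. exact: linearZ. Qed.
Lemma ev0r b : ev b 0 = 0.
Proof. exact: linear0. Qed.
Lemma evPl a b c x : ev (a *: b + c) x = a * ev b x + ev c x.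
Proof. exact: (linearP (evl x)). Qed.
Lemma evDl b c x : ev (b + c) x = ev b x + ev c x.
Proof. exact: (linearD (evl x)). Qed.
Lemma evBl b c x : ev (b - c) x = ev b x - ev c x.
Proof. exact: (linearB (evl x)). Qed.
Lemma evZl a b x : ev (a *: b) x = a * ev b x.
Proof. by rewrite -[a *: b]addr0 evPl [X in _ + X](linear0 (evl x)) addr0. Qed.
Lemma ev0l x : ev 0 x = 0.
Proof. exact: (linear0 (evl x)). Qed.
Lemma ev_suml (I : finType) (u : I -> B) x :
  ev (\sum_i u i) x = \sum_i ev (u i) x.
Proof. exact: (linear_sum (evl x)). Qed.

(** B is an H-module algebra: x . (b c) = sum (x_1 . b)(x_2 . c). This is the multiplicativity of
    the comultiplication, transposed; [ltransM] is the other side. *)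
Lemma rtransM x b c : rtrans x (b * c) =
  \sum_i \sum_j D x i j *: (rtrans (h_ i) b * rtrans (h_ j) c).
Proof.
apply: ev_inj => y; rewrite ev_rtrans evMM ev_sum2.
under eq_bigr => i _ do (under eq_bigr => j _ do rewrite mulr_sumr;
  rewrite exchange_big; under eq_bigr => i' _ do
   (under eq_bigr => j _ do rewrite mulr_sumr; rewrite exchange_big)).
rewrite exchange_big; apply: eq_bigr => i' _ /=.
rewrite exchange_big; apply: eq_bigr => j' _ /=.
rewrite evM mulr_sumr; apply: eq_bigr => i _.
rewrite mulr_sumr; apply: eq_bigr => j _.
by rewrite !ffunE mulrCA.
Qed.

Lemma ltransM x b c : ltrans x (b * c) =
  \sum_i \sum_j D x i j *: (ltrans (h_ i) b * ltrans (h_ j) c).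
Proof.
apply: ev_inj => y; rewrite ev_ltrans evMM ev_sum2.
apply: eq_bigr => i _; apply: eq_bigr => j _; congr (_ * _).
by rewrite evM; apply: eq_bigr => i' _; apply: eq_bigr => j' _; rewrite !ffunE.
Qed.

Lemma antipr (V : lmodType K) (F : {linear H -> V}) x :
  \sum_i \sum_j D x i j *: F (h_ i * S (h_ j)) = (e x : K) *: F 1.
Proof.
have [_ _ _ _ /(_ x)[_ E]] := hopfD.
rewrite -linearZ /= -E linear_sum; apply: eq_bigr => i _.
by rewrite linear_sum; apply: eq_bigr => j _; rewrite linearZ.
Qed.

Lemma antipl (V : lmodType K) (F : {linear H -> V}) x :
  \sum_i \sum_j D x i j *: F (S (h_ i) * h_ j) = (e x : K) *: F 1.
Proof.
have [_ _ _ _ /(_ x)[E _]] := hopfD.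
rewrite -linearZ /= -E linear_sum; apply: eq_bigr => i _.
by rewrite linear_sum; apply: eq_bigr => j _; rewrite linearZ.
Qed.

Lemma counit_linE (V : lmodType K) (F : 'I_d -> V) x :
  \sum_i \sum_j D x i j *: ((e (h_ i) : K) *: F j) = \sum_k hco k x *: F k.
Proof.
rewrite exchange_big; apply: eq_bigr => j _ /=.
rewrite -counit_coef scaler_suml.
by apply: eq_bigr => i _; rewrite scalerA.
Qed.

Lemma counit_linl (V : lmodType K) (F : {linear H -> V}) x :
  \sum_i \sum_j D x i j *: ((e (h_ i) : K) *: F (h_ j)) = F x.
Proof.
rewrite (counit_linE (fun j => F (h_ j))) {2}[x]hb_expand linear_sum.
by apply: eq_bigr => k _; rewrite linearZ.
Qed.

Lemma counit_linr (V : lmodType K) (F : {linear H -> V}) x :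
  \sum_i \sum_j D x i j *: ((e (h_ j) : K) *: F (h_ i)) = F x.
Proof.
rewrite -[RHS]counit_linl exchange_big /=.
by apply: eq_bigr => i _; apply: eq_bigr => j _; rewrite comul_sym.
Qed.

(* (h . b) c = h_1 . (b (S(h_2) . c)), valid in any module algebra. *)
Lemma rtrans_mul x b c : rtrans x b * c =
  \sum_i \sum_j D x i j *: rtrans (h_ i) (b * rtrans (S (h_ j)) c).
Proof.
under eq_bigr => i _ do under eq_bigr => j _ do rewrite rtransM.
under eq_bigr => i _ do under eq_bigr => j _ do
  under eq_bigr => a _ do under eq_bigr => b0 _ do rewrite rtrans_comp.
rewrite coassoc.
transitivity (\sum_a \sum_j D x a j *: ((e (h_ j) : K) *: (rtrans (h_ a) b * c))).
  rewrite -[rtrans x b]/(rtransl b x) -(counit_linr (rtransl b)) mulr_suml.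
  apply: eq_bigr => a _; rewrite mulr_suml; apply: eq_bigr => j _.
  by rewrite -!scalerAl.
apply: eq_bigr => a _; apply: eq_bigr => j _; congr (_ *: _).
rewrite [LHS]scalerAr -[c in LHS]rtrans1 -(antipr (rtransl c)) mulr_sumr.
by apply: eq_bigr => i _; rewrite mulr_sumr; apply: eq_bigr => k _; rewrite scalerAr.
Qed.

End HopfDual.

(** * Induction on spans and on products of subspaces *)

Lemma span_ind (K : fieldType) (V : vectType K) (X : seq V) (P : V -> Prop) :
  P 0 -> (forall a u v, P u -> P v -> P (a *: u + v)) ->
  (forall u, u \in X -> P u) -> forall v, v \in <<X>>%VS -> P v.
Proof.
move=> P0 Plin PX v; rewrite -[X]in_tupleE => /coord_span->.
apply: (big_ind P) => //= [a b Pa Pb | i _].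
  by rewrite -[a]scale1r; apply: Plin.
rewrite -[_ *: _]addr0; apply: Plin => //; apply: PX.
by rewrite mem_nth.
Qed.

Lemma prodv_ind (K : fieldType) (A : falgType K) (U W : {vspace A}) (P : A -> Prop) :
  P 0 -> (forall a u v, P u -> P v -> P (a *: u + v)) ->
  (forall u w, u \in U -> w \in W -> P (u * w)) ->
  forall v, v \in (U * W)%VS -> P v.
Proof.
move=> P0 Plin PM v; rewrite [@prodv K A]unlock; apply: span_ind => // x.
by case/allpairsP=> -[u w] /= [/vbasis_mem Uu /vbasis_mem Ww ->]; apply: PM.
Qed.

(** * Additivity of Frobenius and tensor squares of coalgebras *)

Section FrobeniusSum.
Variables (R : comNzRingType) (q : nat).
Hypothesis qP : [pchar R].-nat q.

Lemma frob_sum (I : finType) (u : I -> R) :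
  (\sum_i u i) ^+ q = \sum_i u i ^+ q.
Proof.
have q0 : (0 < q)%N by case/andP: qP.
apply: (big_morph (fun x => x ^+ q)) => [x y|]; first exact: exprDn_pchar.
by rewrite expr0n eqn0Ngt q0.
Qed.

End FrobeniusSum.

Local Notation square T := (fintype.Datatypes_prod__canonical__fintype_Finite T T).

(** The tensor square of C. It is transparent because [cog] of the square has to reduce to a product
    of two coefficients of C. *)
Definition cocoalg2 (K : fieldType) (T : finType) (C : cocoalg K T) :
  cocoalg K (square T).
Proof.
refine (@Cocoalg K _ (fun x a b => cog C x.1 a.1 b.1 * cog C x.2 a.2 b.2)
  (fun x => cou C x.1 * cou C x.2) _ _ _ _).
- move=> x a b c.
  transitivity ((\sum_i cog C x.1 i c.1 * cog C i a.1 b.1) *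
                (\sum_i cog C x.2 i c.2 * cog C i a.2 b.2)).
    rewrite mulr_suml -(pair_bigA _ (fun i j =>
      cog C x.1 i c.1 * cog C x.2 j c.2 * (cog C i a.1 b.1 * cog C j a.2 b.2))) /=.
    by apply: eq_bigr => i _; rewrite mulr_sumr; apply: eq_bigr => j _; rewrite mulrACA.
  rewrite !cogA mulr_suml -(pair_bigA _ (fun i j =>
    cog C x.1 a.1 i * cog C x.2 a.2 j * (cog C i b.1 c.1 * cog C j b.2 c.2))) /=.
  by apply: eq_bigr => i _; rewrite mulr_sumr; apply: eq_bigr => j _; rewrite mulrACA.
- by move=> x a b; rewrite !(cogC _ _ a.1) !(cogC _ _ a.2).
- move=> x j; rewrite -pair_eqE /= -mulnb natrM -!(cog_cou C) mulr_suml.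
  rewrite -(pair_bigA _ (fun i i' =>
    cog C x.1 i j.1 * cog C x.2 i' j.2 * (cou C i * cou C i'))) /=.
  by apply: eq_bigr => i _; rewrite mulr_sumr; apply: eq_bigr => k _; rewrite mulrACA.
- by have [x nx] := cou_neq0 C; exists (x, x); rewrite mulf_neq0.
Defined.

Section TensorSquare.
Variables (K : fieldType) (T : finType) (C : cocoalg K T).

Definition tensor2 (u v : cdual C) : cdual (cocoalg2 C) := [ffun x => (u x.1 : K) * v x.2].

Lemma tensor2M u v u' v' : tensor2 (u * u') (v * v') = tensor2 u v * tensor2 u' v'.
Proof.
apply/ffunP=> -[x1 x2].
rewrite cdualM !ffunE /= mulr_suml.
under [RHS]eq_bigr => a _ do under eq_bigr => b _ do rewrite !ffunE.
rewrite -[RHS](pair_bigA _ (fun a a' => \sum_b cog C x1 a b.1 * cog C x2 a' b.2 *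
   ((u a : K) * v a' * ((u' b.1 : K) * v' b.2)))).
apply: eq_bigr => a _; rewrite mulr_sumr; apply: eq_bigr => a' _ /=.
rewrite -[RHS](pair_bigA _ (fun b b' => cog C x1 a b * cog C x2 a' b' *
   ((u a : K) * v a' * ((u' b : K) * v' b')))).
rewrite mulr_suml; apply: eq_bigr => b _; rewrite mulr_sumr; apply: eq_bigr => b' _.
by rewrite mulrACA [u a * _ * _]mulrACA.
Qed.

Lemma tensor2X u v q : (0 < q)%N -> tensor2 u v ^+ q = tensor2 (u ^+ q) (v ^+ q).
Proof.
by case: q => // q _; elim: q => // q IH; rewrite exprS IH -tensor2M -!exprS.
Qed.

End TensorSquare.

(** * Orthogonality between H and B, and the Hopf algebra structure of B *)

Section HopfDual2.
Variables (K : fieldType) (H : falgType K).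
Local Notation d := (\dim (fullv : {vspace H})).
Variables (D : 'Hom(H, 'M[K]_(d, d))) (e : 'Hom(H, K^o)) (S : 'End(H)).
Hypotheses (hopfD : is_hopf D e S) (cocoD : cocommutative D).
Local Notation h_ := (@hb K H).
Local Notation B := (cdual (hopf_cocoalg hopfD cocoD)).
Local Notation B2 := (cdual (cocoalg2 (hopf_cocoalg hopfD cocoD))).
Implicit Types (x y z : H) (i j k : 'I_d) (b c : B) (W : {vspace B}).

Definition delta k : B := [ffun j => (k == j)%:R].

Lemma cdual_expand b : b = \sum_k (b k : K) *: delta k.
Proof.
apply/ffunP=> j; rewrite sum_ffunE (bigD1 j) //= big1 => [|k /negPf njk].
  by rewrite !ffunE eqxx -[_ *: _]/(_ * _) mulr1 addr0.
by rewrite !ffunE njk scaler0.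
Qed.

Lemma ev_delta k x : ev (delta k) x = hco k x.
Proof.
rewrite /ev (bigD1 k) //= big1 => [|j /negPf njk].
  by rewrite ffunE eqxx mulr1 addr0.
by rewrite ffunE eq_sym njk mulr0.
Qed.

Lemma evl_surj (f : {linear B -> K^o}) : exists g, forall b, f b = ev b g.
Proof.
exists (\sum_k (f (delta k) : K) *: h_ k) => b.
rewrite {1}[b]cdual_expand linear_sum ev_sumr; apply: eq_bigr => k _.
by rewrite linearZ /= ev_hb; apply: mulrC.
Qed.

(** The coordinate functionals of W extend to B, and by finite dimension a functional on B is
    evaluation at some element of H. *)
Lemma dual_basis W : exists g : 'I_(\dim W) -> H,
  forall b, b \in W -> b = \sum_k ev b (g k) *: (vbasis W)`_k.
Proof.
have /fin_all_exists[g gP] (k : 'I_(\dim W)) :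
    exists g, forall b, coord (vbasis W) k b = ev b g.
  exact: (evl_surj (coord (vbasis W) k : {linear B -> K^o})).
exists g => b Wb; rewrite {1}(coord_vbasis Wb).
by apply: eq_bigr => k _; rewrite gP.
Qed.

(** Double orthogonality in B: evaluation at y composed with [\1 - projv W] kills W and is
    represented by an element of H. *)
Lemma sepB W b :
  (forall x, (forall c, c \in W -> ev c x = 0) -> ev b x = 0) -> b \in W.
Proof.
move=> bP; suff: b - projv W b = 0 by move/subr0_eq->; apply: memv_proj.
apply: ev_inj => y; rewrite ev0l.
have [g gP] := evl_surj (evl y \o (\1 - projv W)%VF).
have E c : ev (c - projv W c) y = ev c g.
  by rewrite -gP /= !lfun_simp /= /evl.
rewrite E; apply: bP => c Wc; rewrite -E projv_id // subrr.
exact: ev0l.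
Qed.

Lemma ev_coord (f : 'End(H)) i x :
  ev ([ffun k => hco i (f (h_ k))] : B) x = hco i (f x).
Proof.
have -> : f x = \sum_k hco k x *: f (h_ k).
  by rewrite {1}[x]hb_expand linear_sum; apply: eq_bigr => k _; rewrite linearZ.
by rewrite hco_sum; apply: eq_bigr => k _; rewrite ffunE.
Qed.

(** The annihilator of U in B. Its generators are the coordinates of the complementary projection
    [\1 - projv U]. *)
Definition perp (U : {vspace H}) : {vspace B} :=
  <<[seq [ffun k => hco i ((\1 - projv U)%VF (h_ k))] : B | i <- enum 'I_d]>>%VS.

Lemma mem_perp (U : {vspace H}) b :
  reflect (forall x, x \in U -> ev b x = 0) (b \in perp U).
Proof.
pose p i : B := [ffun k => hco i ((\1 - projv U)%VF (h_ k))].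
have pE i x : ev (p i) x = hco i (x - projv U x).
  by rewrite ev_coord !lfun_simp.
apply: (iffP idP) => [|bP].
  apply: (@span_ind _ _ _ (fun b : B => forall x, x \in U -> ev b x = 0))
    => [x _|a u v Pu Pv x Ux|_ /mapP[i _ ->] x Ux].
  - exact: ev0l.
  - by rewrite evPl Pu ?Pv // mulr0 addr0.
  by rewrite [LHS]pE projv_id // subrr /hco linear0.
suff ->: b = \sum_i b i *: p i.
  by apply: memv_suml => i _; apply/memvZ/memv_span/map_f; rewrite mem_enum.
apply: ev_inj => x; rewrite ev_sum.
under eq_bigr => i _ do rewrite pE mulrC.
rewrite -[RHS]/(ev b (x - projv U x)) evBr [ev b (projv _ _)]bP ?subr0 //.
exact: memv_proj.
Qed.

Lemma sepH (U : {vspace H}) x : (forall b, b \in perp U -> ev b x = 0) -> x \in U.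
Proof.
move=> xP; suff: x - projv U x = 0 by move/subr0_eq->; apply: memv_proj.
rewrite [LHS]hb_expand big1 // => i _; suff ->: hco i (x - projv U x) = 0.
  exact: scale0r.
pose p : B := [ffun k => hco i ((\1 - projv U)%VF (h_ k))].
have pE y : ev p y = hco i (y - projv U y).
  by rewrite ev_coord !lfun_simp.
rewrite -pE; apply: xP; apply/mem_perp => y Uy.
by rewrite pE projv_id // subrr /hco linear0.
Qed.

(* Q x is the convolution candidate for (S x) . (b c); the identity Y says that both have
   the same left convolution product with the identity, whence they agree. *)
Lemma antipM b c : antip (b * c) = antip b * antip c.
Proof.
pose Q x : B := \sum_k \sum_l D x k l *: (rtrans (S (h_ k)) b * rtrans (S (h_ l)) c).
have QE x : Q x = \sum_k hco k x *: Q (h_ k).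
  rewrite /Q; under [RHS]eq_bigr => m _ do (rewrite scaler_sumr;
    under eq_bigr => k _ do rewrite scaler_sumr).
  rewrite [RHS]exchange_big; apply: eq_bigr => k _.
  rewrite [RHS]exchange_big; apply: eq_bigr => l _ /=.
  by rewrite comul_expand scaler_suml; apply: eq_bigr => m _; rewrite scalerA.
have Y x : \sum_i \sum_j D x i j *: rtrans (h_ i) (Q (h_ j)) = (e x : K) *: (b * c).
  under eq_bigr => i _ do (under eq_bigr => j _ do (rewrite linear_sum;
    under eq_bigr => k _ do (rewrite linear_sum;
    under eq_bigr => l _ do rewrite linearZ))).
  rewrite -(coassoc hopfD) /=.
  transitivity (\sum_i \sum_j D x i j *: (rtrans (h_ i * S (h_ j)) c * b)).
    apply: eq_bigr => i _; apply: eq_bigr => j _; congr (_ *: _).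
    rewrite -rtrans_comp rtrans_mul; apply: eq_bigr => k _; apply: eq_bigr => l _.
    by rewrite mulrC.
  rewrite [RHS]scalerAr [RHS]mulrC [LHS](_ : _ = ((e x : K) *: rtransl c 1) * b); last first.
    rewrite -(antipr hopfD) mulr_suml; apply: eq_bigr => i _.
    by rewrite mulr_suml; apply: eq_bigr => j _; rewrite -scalerAl.
  by rewrite /rtransl rtrans1.
have QS x : Q x = rtrans (S x) (b * c).
  transitivity (\sum_i \sum_j D x i j *: rtrans (S (h_ i)) ((e (h_ j) : K) *: (b * c))).
    under [RHS]eq_bigr => i _ do under eq_bigr => j _ do
      (rewrite -Y linear_sum; under eq_bigr => k _ do (rewrite linear_sum;
       under eq_bigr => l _ do rewrite linearZ /= rtrans_comp)).
    rewrite -(coassoc hopfD) QE -(counit_linE hopfD).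
    apply: eq_bigr => i _; apply: eq_bigr => j _; congr (_ *: _).
    rewrite -[X in _ *: X = _]rtrans1 -[X in _ *: X = _]/(rtransl _ 1) -(antipl hopfD).
    by apply: eq_bigr => k _; apply: eq_bigr => l _.
  under eq_bigr => i _ do under eq_bigr => j _ do rewrite linearZ /=.
  exact: (counit_linr hopfD cocoD (rtransl (b * c) \o S : {linear H -> B}) x).
apply: ev_inj => x; rewrite ev_antip -[S x]mul1r -ev_rtrans -QS evM ev_sum2.
by apply: eq_bigr => k _; apply: eq_bigr => l _; rewrite evM1 !ev_rtrans !mul1r !ffunE.
Qed.

Lemma antipX b n : antip (b ^+ n.+1) = antip b ^+ n.+1.
Proof. by elim: n => // n IH; rewrite exprS antipM IH -exprS. Qed.

(* For c in a, the sum of c_1 S(c_2) is c(1) 1 and lies in a. *)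
Lemma hopf_ideal_unit (R : {vspace B}) (a : B -> Prop) :
  (forall x b, b \in R -> ltrans x b \in R) ->
  (forall b, b \in R -> antip b \in R) ->
  (forall c, a c -> c \in R) ->
  a 0 -> (forall b c, a b -> a c -> a (b + c)) ->
  (forall b c, a b -> c \in R -> a (b * c)) ->
  (forall x b, a b -> a (rtrans x b)) ->
  forall c, a c -> c != 0 -> a 1.
Proof.
move=> ltR sgR aR a0 aD aM art c0 ac0 nz0.
have [c ac nzc]: exists2 c, a c & ev c 1 != 0.
  suff [k nzk]: exists k, c0 k != 0.
    by exists (rtrans (h_ k) c0); [exact: art | rewrite ev_rtrans mul1r ev_hb].
  apply/existsP; apply: contraNT nz0; rewrite negb_exists => /forallP c0P.
  by apply/eqP/ffunP=> k; rewrite ffunE; apply/eqP/negbNE/c0P.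
have [g gP] := dual_basis R.
(* R is stable under [ltrans], so the coproduct of c can be written with second factors in a basis
   of R; the first factors are translates of c. *)
have cE x y : ev c (x * y) = \sum_k ev (rtrans (g k) c) x * ev (vbasis R)`_k y.
  rewrite -ev_ltrans {1}(gP (ltrans x c)) ?ltR ?aR // ev_sum.
  by apply: eq_bigr => k _; rewrite ev_ltrans ev_rtrans.
have E : \sum_k rtrans (g k) c * antip (vbasis R)`_k = ev c 1 *: 1.
  apply: ev_inj => x; rewrite evZl ev1l ev_suml.
  rewrite mulrC -[RHS](antipr hopfD (ev c : {linear H -> K^o}) x) /=.
  under [RHS]eq_bigr => i _ do under eq_bigr => j _ do rewrite cE scaler_sumr.
  under eq_bigr => k _ do rewrite evM.
  under [RHS]eq_bigr => i _ do rewrite exchange_big.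
  rewrite [RHS]exchange_big; apply: eq_bigr => k _.
  by apply: eq_bigr => i _; apply: eq_bigr => j _; rewrite ev_hb -ev_antip ev_hb.
have asum : a (ev c 1 *: 1).
  rewrite -E; apply: (big_ind a) => // k _; apply: aM; first exact: art.
  by apply: sgR; apply/vbasis_mem/mem_nth; rewrite size_tuple.
(* Closure of [a] under scalars is obtained from [aM], by multiplying with the element c(1)^-1 1 of
   R. *)
have R1 : 1 \in R.
  by rewrite -[1]scale1r -(mulVf nzc) -scalerA memvZ ?aR.
have := aM _ ((ev c 1)^-1 *: 1) asum (memvZ _ R1).
by rewrite -scalerAr mulr1 scalerA mulVf // scale1r.
Qed.

(** The comultiplication of B, the transpose of the product of H. *)
Definition comul b : B2 := [ffun x => ev b (h_ x.1 * h_ x.2)].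

Lemma comulM b c : comul (b * c) = comul b * comul c.
Proof.
apply/ffunP=> -[x1 x2].
rewrite cdualM ffunE evMM /=.
under [RHS]eq_bigr => i _ do under eq_bigr => j _ do rewrite !ffunE.
rewrite -[RHS](pair_bigA _ (fun i i' => \sum_j D (h_ x1) i j.1 * D (h_ x2) i' j.2 *
   (ev b (h_ i * h_ i') * ev c (h_ j.1 * h_ j.2)))).
apply: eq_bigr => i _.
under eq_bigr => j _ do rewrite mulr_sumr.
rewrite exchange_big; apply: eq_bigr => i' _ /=.
rewrite -[RHS](pair_bigA _ (fun j j' => D (h_ x1) i j * D (h_ x2) i' j' *
   (ev b (h_ i * h_ i') * ev c (h_ j * h_ j')))).
apply: eq_bigr => j _; rewrite mulr_sumr; apply: eq_bigr => j' _.
by rewrite mulrA.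
Qed.

Lemma comulX b q : (0 < q)%N -> comul b ^+ q = comul (b ^+ q).
Proof.
by case: q => // q _; elim: q => // q IH; rewrite exprS IH -comulM -!exprS.
Qed.

Lemma comul_tensorP b (I : finType) (u v : I -> B) :
  comul b = \sum_k tensor2 (u k) (v k) <->
  forall x y, ev b (x * y) = \sum_k ev (u k) x * ev (v k) y.
Proof.
split=> [/ffunP E x y | E]; last first.
  by apply/ffunP=> -[i j]; rewrite sum_ffunE !ffunE E; apply: eq_bigr => k _;
    rewrite !ffunE !ev_hb.
have E1 j : rtrans (h_ j) b = \sum_k v k j *: u k.
  apply/ffunP=> i; rewrite sum_ffunE.
  have := E (i, j); rewrite sum_ffunE !ffunE /= => ->.
  by apply: eq_bigr => k _; rewrite !ffunE mulrC.
have -> : ev b (x * y) = ev (\sum_k ev (u k) x *: v k) y; last by rewrite ev_sum.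
rewrite -ev_ltrans; congr (ev _ y); apply/ffunP=> j.
rewrite sum_ffunE ffunE -ev_rtrans E1 ev_sum.
by apply: eq_bigr => k _; rewrite ffunE mulrC.
Qed.

(** [comul] is multiplicative, and the q-th power map of the tensor square is additive and acts
    factorwise on pure tensors. *)
Lemma comul_frob p r b (I : finType) (u v : I -> B) : p \in [pchar K] ->
  (forall x y, ev b (x * y) = \sum_k ev (u k) x * ev (v k) y) ->
  let q := (p ^ r)%N in
  forall x y, ev (b ^+ q) (x * y) = \sum_k ev (u k ^+ q) x * ev (v k ^+ q) y.
Proof.
move=> pK /comul_tensorP E q; apply/comul_tensorP.
have p_pr := pcharf_prime pK.
have q0 : (0 < q)%N by rewrite expn_gt0 prime_gt0.
have qP : [pchar B2].-nat q.
  by rewrite pnatX (eq_pnat _ (pchar_lalg _)) pnatE // pK.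
rewrite -comulX // E frob_sum //; apply: eq_bigr => k _; exact: tensor2X.
Qed.

End HopfDual2.

Lemma linear_prodv_sub (K : fieldType) (A : falgType K) (U W P : {vspace A})
    (f : {linear A -> A}) :
  (forall u w, u \in U -> w \in W -> f (u * w) \in P) ->
  forall y, y \in (U * W)%VS -> f y \in P.
Proof.
move=> fP; apply: prodv_ind => //; first by rewrite linear0 mem0v.
by move=> a u v Pu Pv; rewrite linearP memvD ?memvZ.
Qed.

(** * Ideals stable under derivations, modulo p-th powers *)

Section FrobeniusKernel.
Variables (K : fieldType) (T : finType) (C : cocoalg K T).
Local Notation A := (cdual C).
(** In the application R is the span of the q-th powers of B, m its augmentation ideal, and L the
    ideal of R generated by the augmentation ideal of the span of the pq-th powers. *)
Variables (p : nat) (R m L : {vspace A}).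
Hypotheses (pK : p \in [pchar K]).
Hypotheses (R1 : 1 \in R) (mR : (m <= R)%VS) (RR : (R * R <= R)%VS).
Hypotheses (Rm : (R * m <= m)%VS) (RL : (R * L <= L)%VS).
Hypothesis mpL : forall y, y \in m -> y ^+ p \in L.

Let pr_p : prime p := pcharf_prime pK.

Section Monomials.
Variables (n : nat) (x : 'I_n -> A).
Hypothesis xm : forall i, x i \in m.

Definition mon (s : seq 'I_n) : A := \prod_(i <- s) x i.

Lemma prod_mem (I : Type) (r : seq I) (P : pred I) (F : I -> A) :
  (forall i, F i \in R) -> \prod_(i <- r | P i) F i \in R.
Proof.
move=> FR; elim/big_ind: _ => // u v Ru Rv.
exact: subvP RR _ (memv_mul Ru Rv).
Qed.

Lemma mon_mem s : mon s \in (m ^+ size s)%VS.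
Proof.
rewrite /mon; elim: s => [|i s IH]; first by rewrite big_nil expv0 memv_line.
by rewrite big_cons expvSl memv_mul.
Qed.

Lemma mon_frob i s : (p <= count_mem i s)%N -> mon s \in L.
Proof.
move=> le_p; rewrite /mon (bigID (pred1 i)) /=.
have -> : \prod_(j <- s | j == i) x j = x i ^+ count_mem i s.
  rewrite (eq_bigr (fun _ => x i)) => [|j /eqP-> //].
  by rewrite big_const_seq -Monoid.iteropE exprnP.
rewrite -(subnK le_p) exprD -mulrA mulrCA mulrC.
have xR j : x j \in R by apply: subvP mR _ (xm j).
apply: (subvP RL); apply: memv_mul; last exact: mpL.
apply: (subvP RR); apply: memv_mul; last exact: prod_mem.
by elim: (_ - _)%N => [|k IH]; rewrite ?expr0 // exprS (subvP RR) ?memv_mul.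
Qed.

Definition mons k : {vspace A} := <<[seq mon t | t : k.-tuple 'I_n]>>%VS.

Lemma mons0 : (1 <= mons 0)%VS.
Proof.
rewrite -memvE; apply: memv_span; apply/mapP; exists [tuple]; first by rewrite mem_enum.
by rewrite /mon big_nil.
Qed.

Lemma monsS k : (<<codom x>> * mons k <= mons k.+1)%VS.
Proof.
apply/prodvP=> u w Xu; move: w.
apply: (@span_ind _ _ _ (fun w => u * w \in mons k.+1)).
- by rewrite mulr0 mem0v.
- by move=> a v w Mv Mw; rewrite mulrDr -scalerAr memvD ?memvZ.
move=> _ /mapP[t _ ->].
move: u Xu; apply: (@span_ind _ _ _ (fun u => u * mon t \in mons k.+1)).
- by rewrite mul0r mem0v.
- by move=> a v w Mv Mw; rewrite mulrDl -scalerAl memvD ?memvZ.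
move=> _ /codomP[i ->]; apply: memv_span; apply/mapP.
by exists [tuple of i :: t]; rewrite ?mem_enum // /mon big_cons.
Qed.

End Monomials.

(** Pigeonhole: with n the dimension of m, a monomial of degree n p + 1 in a basis of m has an
    exponent at least p, hence lies in L by [mon_frob]. *)
Lemma exp_sub_frob : exists N, (m ^+ N.+1 <= L)%VS.
Proof.
pose n := \dim m; pose x (i : 'I_n) : A := (vbasis m)`_i.
have xm i : x i \in m by apply/vbasis_mem/mem_nth; rewrite size_tuple.
have mx : (m <= <<codom x>>)%VS.
  rewrite -{1}(span_basis (vbasisP m)); apply: sub_span => u.
  move/(nthP 0)=> [j]; rewrite size_tuple => ltj <-.
  by apply/codomP; exists (Ordinal ltj).
exists (n * p)%N; apply: (@subv_trans _ _ (mons x (n * p).+1)).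
  elim: (_.+1) => [|k IH]; first exact: mons0.
  by rewrite expvSl; apply: subv_trans (monsS x k); apply: prodvS.
apply/span_subvP=> _ /mapP[t _ ->].
suff [i] : exists i, (p <= count_mem i t)%N by apply: mon_frob.
apply/existsP; apply: contraT; rewrite negb_exists => /forallP lt_p.
have: (\sum_(i < n) count_mem i t <= n * p)%N.
  apply: (@leq_trans (\sum_(i < n) p)); last by rewrite sum_nat_const card_ord.
  by apply: leq_sum => i _; apply: ltnW; rewrite ltnNge lt_p.
rewrite leqNgt => /negP[].
suff -> : (\sum_(i < n) count_mem i t)%N = size t by rewrite size_tuple.
elim: (t : seq _) => [|j s IH] /=; first by rewrite big1.
rewrite big_split /= IH -add1n; congr (_ + _)%N.
by rewrite (bigD1 j) //= eqxx big1 // => i /negPf; rewrite eq_sym => ->.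
Qed.

Section Derivations.
Variables (n : nat) (x : 'I_n -> A) (dl : 'I_n -> {linear A -> A}).
Hypothesis xm : forall i, x i \in m.
Hypothesis mx : (m <= <<codom x>> + m * m)%VS.
Hypothesis dlR : forall i y, y \in R -> dl i y \in R.
Hypothesis dlL : forall i y, y \in L -> dl i y \in L.
Hypothesis dlM : forall i y z, y \in R -> z \in R ->
  dl i (y * z) = dl i y * z + y * dl i z.
Hypothesis dlx : forall i j, dl i (x j) - (i == j)%:R \in m.

(** The m-adic filtration modulo L; by [exp_sub_frob] it reaches L. *)
Local Notation F k := (m ^+ k + L)%VS.

(* Modulo higher order terms, the monomials in x are eigenvectors of E i, with eigenvalue
   the exponent of x i. *)
Let E i y := x i * dl i y.

(** Exponents start at 1 because [m ^+ 0] is the line of 1, in general not an R-submodule. *)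
Lemma Rexp k : (R * m ^+ k.+1 <= m ^+ k.+1)%VS.
Proof. by rewrite expvSl prodvA; apply: prodvSl. Qed.

Lemma expR k : (m ^+ k.+1 <= R)%VS.
Proof.
elim: k => [|k IH]; first by rewrite expv1.
by rewrite expvSl; apply: subv_trans RR; apply: prodvS.
Qed.

Lemma dl1 i : dl i 1 = 0.
Proof.
have /eqP := dlM i R1 R1.
by rewrite !mulr1 mul1r addrC -subr_eq subrr eq_sym => /eqP.
Qed.

Lemma dl_exp i k y : y \in (m ^+ k.+2)%VS -> dl i y \in (m ^+ k.+1)%VS.
Proof.
elim: k y => [|k IH] y; rewrite expvSl;
  apply: linear_prodv_sub => {y} u v mu mv.
  rewrite expv1 in mv *.
  rewrite dlM ?(subvP mR) // memvD //; last rewrite mulrC.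
    by apply: (subvP Rm); rewrite memv_mul ?dlR ?(subvP mR).
  by apply: (subvP Rm); rewrite memv_mul ?dlR ?(subvP mR).
have Ru := subvP mR _ mu; rewrite dlM ?(subvP (expR k.+1) v) //.
rewrite memvD //; first by apply: (subvP (Rexp _)); rewrite memv_mul ?dlR.
by rewrite expvSl memv_mul ?IH.
Qed.

Lemma E_exp i k y : y \in (m ^+ k.+1)%VS -> E i y \in (m ^+ k.+1)%VS.
Proof.
rewrite /E; case: k => [|k] my; last by rewrite expvSl memv_mul ?dl_exp.
rewrite expv1 mulrC; apply: (subvP Rm); rewrite memv_mul ?dlR //.
by apply: (subvP mR); rewrite -[m]expv1.
Qed.

Lemma E_linear i : linear (E i).
Proof. by move=> a u v; rewrite /E linearP mulrDr scalerAr. Qed.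

Lemma iterE_exp i k j y : y \in (m ^+ k.+1)%VS -> iter j (E i) y \in (m ^+ k.+1)%VS.
Proof. by move=> my; elim: j => //= j IH; apply: E_exp. Qed.

Lemma E_L i y : y \in L -> E i y \in L.
Proof. by move=> Ly; apply: (subvP RL); rewrite memv_mul ?dlL ?(subvP mR). Qed.

Lemma E_F i k y : y \in F k.+1 -> E i y \in F k.+1.
Proof.
case/memv_addP=> u mu [v Lv ->]; rewrite /E linearD mulrDr -!/(E i _).
by rewrite memv_add ?E_exp ?E_L.
Qed.

(** Euler's relation. In the Leibniz rule, replacing [dl i (x j)] by the Kronecker symbol leaves an
    error with one more factor in m. *)
Lemma E_mon i s : E i (mon x s) - (count_mem i s)%:R *: mon x s \in (m ^+ (size s).+1)%VS.
Proof.
rewrite /mon; elim: s => [|j s IH].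
  by rewrite big_nil /E dl1 mulr0 scale0r subr0 mem0v.
rewrite big_cons /=; set M := \prod_(_ <- s) _ in IH *.
have MR : M \in R by apply: prod_mem => k; apply: (subvP mR).
have -> : E i (x j * M) - ((j == i) + count_mem i s)%:R *: (x j * M) =
    x i * ((dl i (x j) - (i == j)%:R) * M) + x j * (E i M - (count_mem i s)%:R *: M).
  have -> : ((j == i) + count_mem i s)%:R *: (x j * M) =
            (i == j)%:R * (x i * M) + x j * ((count_mem i s)%:R *: M).
    rewrite natrD scalerDl; congr (_ + _); last exact: scalerAr.
    by rewrite scaler_nat mulr_natl [j == i]eq_sym; case: eqP => [->|] // _; rewrite !mulr0n.
  rewrite /E dlM ?(subvP mR _ (xm j)) //.
  move: (dl i (x j)) (dl i M) ((count_mem i s)%:R *: M) => u v w; ring.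
rewrite memvD //; last by rewrite expvSl memv_mul.
by rewrite !expvSl; do 2?[rewrite memv_mul //]; apply: mon_mem.
Qed.

(* By Fermat, 1 - (E i)^(p-1) kills the monomials whose exponent in x i is prime to p. *)
Let G i y := y - iter p.-1 (E i) y.

Lemma iterE_linear i j : linear (iter j (E i)).
Proof. by move=> a u v; elim: j => //= j ->; apply: E_linear. Qed.

Lemma G_linear i : linear (G i).
Proof.
by move=> a u v; rewrite /G iterE_linear opprD addrACA scalerBr.
Qed.

Lemma G_B i u v : G i (u - v) = G i u - G i v.
Proof. by rewrite addrC -scaleN1r G_linear scaleN1r addrC. Qed.

Lemma G_F i k y : y \in F k.+1 -> G i y \in F k.+1.
Proof. by move=> Fy; rewrite memvB //; elim: p.-1 => //= j IH; apply: E_F. Qed.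

Lemma G_L i y : y \in L -> G i y \in L.
Proof. by move=> Ly; rewrite memvB //; elim: p.-1 => //= j IH; apply: E_L. Qed.

Lemma G_exp i k y : y \in (m ^+ k.+1)%VS -> G i y \in (m ^+ k.+1)%VS.
Proof. by move=> my; rewrite memvB // iterE_exp. Qed.

Lemma E_exp_le i j s : iter j (E i) (mon x s) - (count_mem i s)%:R ^+ j *: mon x s
  \in (m ^+ (size s).+1)%VS.
Proof.
elim: j => [|j IH]; first by rewrite expr0 scale1r subrr mem0v.
set c : K := (_)%:R in IH *; rewrite iterS.
have := E_exp i IH; rewrite -scaleN1r addrC E_linear scaleN1r -/(iter _ _ _).
move: (E i (iter _ _ _)) => y Ey.
have -> : y - c ^+ j.+1 *: mon x s =
  (- E i (c ^+ j *: mon x s) + y) + c ^+ j *: (E i (mon x s) - c *: mon x s).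
  have -> : E i (c ^+ j *: mon x s) = c ^+ j *: E i (mon x s).
    by rewrite /E linearZ scalerAr.
  by rewrite scalerBr scalerA -exprSr [- _ + y]addrC -addrA addKr.
by rewrite memvD // memvZ // E_mon.
Qed.

(** Taken over all i, this suppresses to leading order every monomial except those whose exponents
    are all divisible by p. *)
Let GG (r : seq 'I_n) y := foldr G y r.

Lemma GG_F r k y : y \in F k.+1 -> GG r y \in F k.+1.
Proof. by move=> Fy; elim: r => //= i r; apply: G_F. Qed.

Lemma GG_linear r : linear (GG r).
Proof. by move=> a u v; elim: r => //= i r ->; apply: G_linear. Qed.

Lemma GG_mon r s :
  GG r (mon x s) - (\prod_(i <- r) (1 - (count_mem i s)%:R ^+ p.-1)) *: mon x s
  \in (m ^+ (size s).+1)%VS.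
Proof.
elim: r => [|i r IH] /=; first by rewrite big_nil scale1r subrr mem0v.
rewrite big_cons; set a := \prod_(_ <- r) _ in IH *; set c : K := _%:R.
have -> : G i (GG r (mon x s)) - ((1 - c ^+ p.-1) * a) *: mon x s =
  G i (GG r (mon x s) - a *: mon x s) -
  a *: (iter p.-1 (E i) (mon x s) - c ^+ p.-1 *: mon x s).
  have -> : G i (GG r (mon x s) - a *: mon x s) =
      G i (GG r (mon x s)) - a *: G i (mon x s).
    by rewrite addrC -scaleNr G_linear scaleNr addrC.
  rewrite mulrBl mul1r scalerBl {3}/G !scalerBr [c ^+ _ * a]mulrC -!scalerA.
  move: (G i _) (a *: _) (a *: _) (a *: _) => u v w t; ring.
by rewrite memvB ?memvZ ?G_exp ?E_exp_le.
Qed.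

Lemma mon_span k : (m ^+ k <= mons x k + m ^+ k.+1)%VS.
Proof.
elim: k => [|k IH].
  by rewrite expv0; apply: subv_trans (mons0 x) (addvSl _ _).
rewrite expvSl (subv_trans (prodvSl _ mx)) // prodvDl subv_add -prodvA -!expvSl addvSr.
rewrite andbT (subv_trans (prodvSr _ IH)) // prodvDr addvS ?monsS //.
rewrite [X in (_ <= X)%VS]expvSl prodvSl //.
by apply/span_subvP=> _ /codomP[i ->].
Qed.

(** If p does not divide some exponent of a monomial, its leading coefficient under [GG] vanishes.
    Otherwise the first letter occurs with a positive multiple of p as exponent, so the monomial
    lies in L. *)
Lemma GG_exp k y : y \in F k.+1 -> GG (index_enum 'I_n) y \in F k.+2.
Proof.
have GL z : z \in L -> GG (index_enum 'I_n) z \in L.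
  by move=> Lz; elim: (index_enum _) => //= i r; apply: G_L.
case/memv_addP=> u mu [v Lv ->].
rewrite -[u]scale1r GG_linear scale1r memvD //; last first.
  by rewrite (subvP (addvSr _ _)) ?GL.
have /memv_addP[w Mw [z mz ->]] := subvP (mon_span k.+1) _ mu.
rewrite -[w]scale1r GG_linear scale1r memvD //; last first.
  by rewrite GG_F // (subvP (addvSl _ _)).
move: w Mw; apply: span_ind => [|a w t Mw Mt|_ /mapP[t _ ->]].
- by rewrite -[0](subrr 0) -scaleN1r addrC GG_linear scaleN1r addrC subrr mem0v.
- by rewrite GG_linear memvD ?memvZ.
have := GG_mon (index_enum 'I_n) t; rewrite size_tuple => GGt.
have [i ndv | dv] := pickP (fun i => ~~ (p %| count_mem i t)%N).
  move: GGt; rewrite (bigD1 i) //=.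
  (* Fermat: c^p = c in K for the image c of a natural number. *)
  have -> : 1 - (count_mem i t)%:R ^+ p.-1 = 0 :> K.
    apply/eqP; rewrite subr_eq0 eq_sym; apply/eqP.
    have nz : (count_mem i t)%:R != 0 :> K by rewrite -(dvdn_pcharf pK).
    apply: (mulfI nz); rewrite -exprS prednK ?prime_gt0 // mulr1.
    exact: (pFrobenius_aut_nat pK).
  by rewrite mul0r scale0r subr0 => ?; rewrite (subvP (addvSl _ _)).
have Lt : mon x t \in L.
  apply: (@mon_frob _ _ _ (tnth t ord0)) => //.
  have := dv (tnth t ord0); case/negbFE/dvdnP=> q cE.
  have : (0 < count_mem (tnth t ord0) t)%N by rewrite -has_count has_pred1 mem_tnth.
  by rewrite cE; case: q {cE} => // q _; rewrite mulSn leq_addr.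
by rewrite (subvP (addvSr _ _)) // GL.
Qed.

(** Split y as (y - GG y) + GG y. [GG_exp] handles the second term. The first is built from iterates
    of the [E i] on y, and [E i y] gains one order from the factor [x i]. *)
Lemma F_step k y : y \in F k.+1 -> (forall i, dl i y \in F k.+1) -> y \in F k.+2.
Proof.
move=> Fy dFy; suff GGy r : y - GG r y \in F k.+2.
  by rewrite -[y](subrK (GG (index_enum 'I_n) y)) memvD ?GG_exp.
have Ey i : E i y \in F k.+2.
  have /memv_addP[u mu [v Lv uvE]] := dFy i.
  by rewrite /E uvE mulrDr memv_add // ?[in m ^+ _]expvSl ?memv_mul //
     (subvP RL) ?memv_mul ?(subvP mR).
elim: r => [|i r IH] /=; first by rewrite subrr mem0v.
have -> : y - G i (GG r y) = iter p.-1 (E i) y + G i (y - GG r y).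
  by rewrite G_B [G i y]/G addrA [iter _ _ _ + _]addrC subrK.
rewrite memvD ?G_F //.
(* Since p - 1 is at least 1, the iterate contains an application of [E i]. *)
have : (0 < p.-1)%N by rewrite -ltnS prednK ?prime_gt1 ?prime_gt0.
case: p.-1 => // j _; rewrite iterSr.
by elim: j => //= j IHj; apply: E_F.
Qed.

(** As P is stable under the derivations, [F_step] raises the order of all its elements together,
    until [exp_sub_frob] puts them in L. *)
Lemma diff_closed_sub_frob (P : A -> Prop) :
  (forall y, P y -> y \in (m * m)%VS) -> (forall i y, P y -> P (dl i y)) ->
  forall y, P y -> y \in L.
Proof.
move=> Pm Pdl; have PF k y : P y -> y \in F k.+1.
  elim: k y => [|k IH] y Py; last by apply: F_step => [|i]; apply: IH => //; apply: Pdl.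
  apply: (subvP (addvSl _ _)); rewrite expv1.
  by apply: subvP Rm _ _; apply: subvP (prodvSl _ mR) _ (Pm _ Py).
have [N leN] := exp_sub_frob.
move=> y /(PF N); case/memv_addP=> u mu [v Lv ->].
by rewrite memvD // (subvP leN).
Qed.

End Derivations.
End FrobeniusKernel.

(** * Frobenius powers of the dual algebra *)

Section HopfFrobenius.
Variables (K : fieldType) (H : falgType K).
Local Notation d := (\dim (fullv : {vspace H})).
Variables (D : 'Hom(H, 'M[K]_(d, d))) (e : 'Hom(H, K^o)) (S : 'End(H)).
Hypotheses (hopfD : is_hopf D e S) (cocoD : cocommutative D).
Local Notation h_ := (@hb K H).
Local Notation B := (cdual (hopf_cocoalg hopfD cocoD)).
Implicit Types (x y z : H) (i j k : 'I_d) (b c : B) (W : {vspace B}).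
Variable p : nat.
Hypothesis pK : p \in [pchar K].

Let pr_p : prime p := pcharf_prime pK.

(** By additivity of Frobenius the powers of a basis already span all p^r-th powers of W. A span is
    taken because K may be imperfect. *)
Definition frobv r W : {vspace B} := <<[seq (u ^+ (p ^ r))%R | u <- vbasis W]>>%VS.

Lemma pexp_gt0 r : (0 < p ^ r)%N. Proof. by rewrite expn_gt0 prime_gt0. Qed.

Lemma pexp_pchar r : [pchar B].-nat (p ^ r)%N.
Proof. by rewrite pnatX (eq_pnat _ (pchar_lalg _)) pnatE // pK. Qed.

Lemma frob_span r (X : seq B) (P : {vspace B}) :
  (forall u, u \in X -> u ^+ (p ^ r) \in P) ->
  forall v, v \in <<X>>%VS -> v ^+ (p ^ r) \in P.
Proof.
move=> XP; apply: span_ind => //; first by rewrite expr0n eqn0Ngt pexp_gt0 mem0v.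
by move=> a u v Pu Pv; rewrite exprDn_pchar ?pexp_pchar // exprZn memvD ?memvZ.
Qed.

Lemma mem_frobv r W w : w \in W -> w ^+ (p ^ r) \in frobv r W.
Proof.
rewrite -{1}(span_basis (vbasisP W)); apply: frob_span => u Wu.
by apply/memv_span/map_f.
Qed.

Lemma frobv_sub r W (P : {vspace B}) :
  (forall w, w \in W -> w ^+ (p ^ r) \in P) -> (frobv r W <= P)%VS.
Proof.
by move=> WP; apply/span_subvP=> _ /mapP[u /vbasis_mem Wu ->]; apply: WP.
Qed.

Lemma frobv_ind r W (Q : B -> Prop) :
  Q 0 -> (forall a u v, Q u -> Q v -> Q (a *: u + v)) ->
  (forall w, w \in W -> Q (w ^+ (p ^ r))) -> forall v, v \in frobv r W -> Q v.
Proof.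
move=> Q0 Qlin QW; apply: span_ind => // _ /mapP[u /vbasis_mem Wu ->].
exact: QW.
Qed.

Lemma frobvM r U W : (frobv r (U * W)%VS <= frobv r U * frobv r W)%VS.
Proof.
apply: frobv_sub; apply: prodv_ind => [|a u v Pu Pv|u w Uu Ww].
- by rewrite expr0n eqn0Ngt pexp_gt0 mem0v.
- by rewrite exprDn_pchar ?pexp_pchar // exprZn memvD ?memvZ.
by rewrite exprMn memv_mul ?mem_frobv.
Qed.

Lemma frobvS r s W v : v \in frobv r W -> v ^+ (p ^ s) \in frobv (r + s) W.
Proof.
apply: frob_span => _ /mapP[u /vbasis_mem Wu ->].
by rewrite -exprM -expnD mem_frobv.
Qed.

Definition frobR r : {vspace B} := frobv r fullv.

Lemma frobR1 r : 1 \in frobR r.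
Proof. by rewrite -(expr1n _ (p ^ r)) mem_frobv ?memvf. Qed.

Lemma frobRM r : (frobR r * frobR r <= frobR r)%VS.
Proof.
apply/prodvP=> u v Ru; move: v.
apply: (@frobv_ind _ _ (fun v => u * v \in frobR r)) => [|a v w Rv Rw|v _].
- by rewrite mulr0 mem0v.
- by rewrite mulrDr -scalerAr memvD ?memvZ.
move: u Ru; apply: (@frobv_ind _ _ (fun u => u * v ^+ (p ^ r) \in frobR r)) =>
  [|a u w Ru Rw|u _].
- by rewrite mul0r mem0v.
- by rewrite mulrDl -scalerAl memvD ?memvZ.
by rewrite -exprMn mem_frobv ?memvf.
Qed.

Lemma frobR_le r s : (frobR (r + s) <= frobR r)%VS.
Proof.
apply: frobv_sub => w _; rewrite addnC expnD exprM.
by rewrite mem_frobv ?memvf.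
Qed.

Lemma ev_split b x y : ev b (x * y) = \sum_k ev (rtrans (h_ k) b) x * ev (delta hopfD cocoD k) y.
Proof.
rewrite {1}[y]hb_expand mulr_sumr.
under eq_bigr => k _ do rewrite -scalerAr.
by rewrite ev_sumr; apply: eq_bigr => k _; rewrite ev_rtrans ev_delta mulrC.
Qed.

(** By [comul_frob] the coproduct of c^q is a sum of tensors of q-th powers. With [frobR_rtrans] and
    [frobR_antip] this makes [frobR r] a Hopf subalgebra of B. *)
Lemma frobR_ltrans r x b : b \in frobR r -> ltrans x b \in frobR r.
Proof.
move: b; apply: (@frobv_ind _ _ (fun b => ltrans x b \in frobR r)) => [|a u v Ru Rv|c _].
- by rewrite linear0 mem0v.
- by rewrite linearP memvD ?memvZ.
have E := comul_frob r pK (ev_split c).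
have -> : ltrans x (c ^+ (p ^ r)) = \sum_k ev (rtrans (h_ k) c ^+ (p ^ r)) x *:
    delta hopfD cocoD k ^+ (p ^ r).
  by apply: ev_inj => y; rewrite ev_ltrans E ev_sum.
by apply: memv_suml => k _; rewrite memvZ ?mem_frobv ?memvf.
Qed.

Lemma frobR_rtrans r x b : b \in frobR r -> rtrans x b \in frobR r.
Proof.
move: b; apply: (@frobv_ind _ _ (fun b => rtrans x b \in frobR r)) => [|a u v Ru Rv|c _].
- by rewrite linear0 mem0v.
- by rewrite linearP memvD ?memvZ.
have E := comul_frob r pK (ev_split c).
have -> : rtrans x (c ^+ (p ^ r)) = \sum_k ev (delta hopfD cocoD k ^+ (p ^ r)) x *:
    (rtrans (h_ k) c ^+ (p ^ r)).
  apply: ev_inj => y; rewrite ev_rtrans E ev_sum.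
  by apply: eq_bigr => k _; rewrite mulrC.
by apply: memv_suml => k _; rewrite memvZ ?mem_frobv ?memvf.
Qed.

Lemma frobR_antip r b : b \in frobR r -> antip b \in frobR r.
Proof.
move: b; apply: (@frobv_ind _ _ (fun b => antip b \in frobR r)) => [|a u v Ru Rv|c _].
- by rewrite linear0 mem0v.
- by rewrite linearP memvD ?memvZ.
by rewrite -(prednK (pexp_gt0 r)) antipX prednK ?pexp_gt0 // mem_frobv ?memvf.
Qed.

(** The augmentation ideal of B, whose counit is evaluation at 1. *)
Definition kerv : {vspace B} := lker (linfun (evl (1 : H) : {linear B -> K^o})).

Lemma mem_kerv b : (b \in kerv) = (ev b 1 == 0).
Proof. by rewrite memv_ker lfunE. Qed.

Lemma ev11 : ev (1 : B) 1 = 1. Proof. by rewrite ev1l (counit1 hopfD). Qed.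

Lemma evX1 b n : ev (b ^+ n) 1 = ev b 1 ^+ n.
Proof. by elim: n => [|n IH]; rewrite ?ev11 // !exprS evM1 IH. Qed.

Lemma frob_kerv b r : b \in kerv -> b ^+ (p ^ r) \in kerv.
Proof.
by rewrite !mem_kerv evX1 => /eqP->; rewrite expr0n eqn0Ngt pexp_gt0.
Qed.

(* A nonzero t in R of minimal dim (t R) either is killed by the augmentation ideal, or
   satisfies (1 - c a) t = 0 with c(1) = 0, and then w (1 - c a) generates a smaller
   ideal than w. *)
Lemma subalg_socle (R : {vspace B}) : 1 \in R -> (R * R <= R)%VS ->
  exists t, [/\ t \in R, t != 0 & forall c, c \in R -> ev c 1 = 0 -> t * c = 0].
Proof.
move=> R1 RR; pose id (w : B) : {vspace B} := (<[w]> * R)%VS.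
have idP w u : reflect (exists2 a, a \in R & u = w * a) (u \in id w).
  apply: (iffP idP) => [|[a Ra ->]]; last by rewrite memv_mul ?memv_line.
  move: u; apply: (@prodv_ind _ _ _ _ (fun u => exists2 a, a \in R & u = w * a)) =>
    [|k u1 u2 [a1 Ra1 ->] [a2 Ra2 ->]|w' a /vlineP[k ->] Ra].
  - by exists 0; rewrite ?mem0v ?mulr0.
  - by exists (k *: a1 + a2); rewrite ?memvD ?memvZ // mulrDr scalerAr.
  by exists (k *: a); rewrite ?memvZ // -scalerAl scalerAr.
have RM u v : u \in R -> v \in R -> u * v \in R.
  by move=> Ru Rv; apply: (subvP RR); apply: memv_mul.
(* The outer induction is on the dimension of w R, with w(1) = 1 keeping w nonzero; the inner one is
   on that of t R for nonzero t in w R. *)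
suff P : forall n w, w \in R -> ev w 1 = 1 -> (\dim (id w) < n)%N ->
    exists t, [/\ t \in R, t != 0 & forall c, c \in R -> ev c 1 = 0 -> t * c = 0].
  exact: (P (\dim (id 1)).+1 1 R1 ev11).
elim=> // n IHn w Rw w1 dimw.
suff P : forall (k : nat) t, t \in id w -> t != 0 -> (\dim (id t) < k)%N ->
    exists t, [/\ t \in R, t != 0 & forall c, c \in R -> ev c 1 = 0 -> t * c = 0].
  apply: (P (\dim (id w)).+1 w) => //; first by apply/idP; exists 1; rewrite ?mulr1.
  by apply: contra_eqN w1 => /eqP->; rewrite ev0l eq_sym oner_neq0.
elim=> // k IHk t wt nzt dimt.
have Rt : t \in R by case/idP: wt => a Ra ->; apply: RM.
case: (boolP (has (fun c => t * c != 0) (vbasis (R :&: kerv)))) =>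
  [/hasP[c /vbasis_mem]|tc0]; last first.
  exists t; split=> // c Rc c1.
  have : c \in (R :&: kerv)%VS by rewrite memv_cap Rc mem_kerv c1 eqxx.
  rewrite -(span_basis (vbasisP (R :&: kerv)%VS)); move: c {Rc c1}.
  apply: span_ind => [|a u v tu tv|u Ru]; first by rewrite mulr0.
    by rewrite mulrDr -scalerAr tu tv scaler0 addr0.
  by apply/eqP; apply: contraR tc0 => ?; apply/hasP; exists u.
rewrite memv_cap mem_kerv => /andP[Rc /eqP c1] nztc.
have sub_tc : (id (t * c)%R <= id t)%VS.
  by apply/subvP=> _ /idP[a Ra ->]; apply/idP; exists (c * a); rewrite ?RM ?mulrA.
have [lt_dim | le_dim] := ltnP (\dim (id (t * c))) (\dim (id t)).
  apply: (IHk (t * c)) => //; last exact: leq_trans lt_dim _.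
  by case/idP: wt => a Ra ->; apply/idP; exists (a * c); rewrite ?RM ?mulrA.
have /idP[a Ra tE] : t \in id (t * c).
  have /eqP-> : id (t * c) == id t by rewrite eqEdim sub_tc.
  by apply/idP; exists 1; rewrite ?mulr1.
pose u := 1 - c * a; have Ru : u \in R by rewrite memvB ?RM.
apply: (IHn (w * u)); first exact: RM.
  by rewrite evM1 w1 mul1r /u evBl ev11 evM1 c1 mul0r subr0.
(* Multiplication by u maps w R onto w u R and kills t, so the dimension drops. *)
pose f := linfun (u \*o idfun : B -> B).
have fE v : f v = u * v by rewrite lfunE.
rewrite -ltnS; apply: leq_trans dimw; rewrite ltnS.
have le_f : (id (w * u)%R <= f @: id w)%VS.
  apply/subvP=> _ /idP[b Rb ->]; apply/memv_imgP; exists (w * b).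
    by apply/idP; exists b.
  by rewrite fE mulrA [u * w]mulrC.
apply: leq_ltn_trans (dimvS le_f) _.
rewrite -(limg_ker_dim f (id w)) -[X in (X < _)%N]add0n ltn_add2r.
rewrite lt0n dimv_eq0; apply: contra_neqN nzt => /eqP k0.
apply/eqP; rewrite -memv0 -k0 memv_cap wt memv_ker fE mulrBl mul1r.
by rewrite [_ * t]mulrC mulrA -tE subrr eqxx.
Qed.

End HopfFrobenius.

(** * Unipotent action of the Frobenius twists *)

Section FrobeniusStep.
Variables (K : fieldType) (H : falgType K).
Local Notation d := (\dim (fullv : {vspace H})).
Variables (D : 'Hom(H, 'M[K]_(d, d))) (e : 'Hom(H, K^o)) (S : 'End(H)).
Hypotheses (hopfD : is_hopf D e S) (cocoD : cocommutative D).
Local Notation h_ := (@hb K H).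
Local Notation B := (cdual (hopf_cocoalg hopfD cocoD)).
Implicit Types (x y z : H) (b c : B) (W : {vspace B}).
Variable p : nat.
Hypothesis pK : p \in [pchar K].
Variable A : {vspace H}.
Hypothesis A1 : 1 \in A.

Let I : {vspace B} := perp hopfD cocoD A.
Local Notation kerv := (kerv hopfD cocoD).

(* The augmentation ideal of the annihilator A_q of the q-th powers of A^perp, q = p^r. *)
Definition twist r x := e x = 0 /\ forall b, b \in frobv p r I -> ev b x = 0.

Lemma perp_kerv b : b \in I -> b \in kerv.
Proof. by move=> Ib; rewrite mem_kerv (elimT (mem_perp _ _) Ib). Qed.

Lemma frobI_kerv r b : b \in frobv p r I -> b \in kerv.
Proof.
move: b; apply: frobv_ind => [|a u v Ku Kv|w Iw]; first exact: mem0v.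
  by rewrite memvD ?memvZ.
exact/frob_kerv/perp_kerv.
Qed.

(** Such u differs from the constant u(1) 1 by an element of A^perp. The q-th power of that element
    is killed by the twist, and the constant by e(x) = 0. *)
Lemma twist_sub (u : B) x r : (forall a, a \in A -> e a = 0 -> ev u a = 0) ->
  twist r x -> ev (u ^+ (p ^ r)) x = 0.
Proof.
move=> uA [ex Ix].
have Iu : u - ev u 1 *: 1 \in I.
  apply/mem_perp => a Aa; rewrite evBl evZl ev1l.
  have := uA (a - e a *: 1); rewrite evBr evZr => <-.
  - by rewrite mulrC.
  - by rewrite memvB ?memvZ.
  by rewrite -!(ev1l hopfD cocoD) evBr evZr ev11 mulr1 subrr.
rewrite -[u](subrK (ev u 1 *: 1)) exprDn_pchar ?pexp_pchar // exprZn expr1n.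
by rewrite evDl evZl ev1l ex mulr0 addr0 Ix ?mem_frobv.
Qed.

Section Invariants.
(** In the application W is [aug_chain], obtained by applying A^+ repeatedly to H. *)
Variables (W : nat -> {vspace H}).
Hypothesis W0 : W 0 = fullv.
Hypothesis WA : forall i x y, x \in A -> e x = 0 -> y \in W i -> x * y \in W i.+1.

(* Since b (x y) = sum u (x) v (y), where each u kills A^+ or each v kills W i, the same
   holds for the q-th powers of the u and the v. *)
Lemma twist_filtration r i b x : b \in frobv p r (perp hopfD cocoD (W i.+1)) ->
  twist r x -> ltrans x b \in frobv p r (perp hopfD cocoD (W i)).
Proof.
move=> + tx; move: b; apply: frobv_ind => [|a u v Ku Kv|c Wc].
- by rewrite linear0 mem0v.
- by rewrite linearP memvD ?memvZ.
pose P := projv (W i).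
pose v k : B := [ffun l => hco k ((\1 - P)%VF (h_ l))].
have vW k : v k \in perp hopfD cocoD (W i).
  by apply/mem_perp => y Wy; rewrite ev_coord !lfun_simp projv_id // subrr /hco linear0.
(* c(y z) = c(y P(z)) + c(y (z - P(z))). In the [inl] terms, from the first summand, the left
   factors vanish on A^+; in the [inr] terms the right factors vanish on [W i]. *)
pose uu (s : 'I_d + 'I_d) := match s with
  | inl k => rtrans (P (h_ k)) c | inr k => rtrans (h_ k) c end.
pose vv (s : 'I_d + 'I_d) := match s with
  | inl k => delta hopfD cocoD k | inr k => v k end.
have E y z : ev c (y * z) = \sum_s ev (uu s) y * ev (vv s) z.
  rewrite big_sumType /=.
  have -> : \sum_k ev (rtrans (h_ k) c) y * ev (v k) z = ev c (y * (z - P z)).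
    rewrite ev_split; apply: eq_bigr => k _; congr (_ * _).
    by rewrite ev_coord !lfun_simp ev_delta.
  have -> : \sum_k ev (rtrans (P (h_ k)) c) y * ev (delta hopfD cocoD k) z = ev c (y * P z).
    have -> : P z = \sum_k hco k z *: P (h_ k).
      by rewrite {1}[z]hb_expand linear_sum; apply: eq_bigr => k _; rewrite linearZ.
    rewrite mulr_sumr; under [X in ev c X]eq_bigr => k _ do rewrite -scalerAr.
    by rewrite ev_sumr; apply: eq_bigr => k _; rewrite ev_rtrans ev_delta mulrC.
  by rewrite -evDr -mulrDr addrC subrK.
have -> : ltrans x (c ^+ (p ^ r)) =
    \sum_s ev (uu s ^+ (p ^ r)) x *: (vv s ^+ (p ^ r)).
  by apply: ev_inj => y; rewrite ev_ltrans (comul_frob r pK E) ev_sum.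
rewrite big_sumType /= memvD //; apply: memv_suml => k _; last first.
  by rewrite memvZ ?mem_frobv.
rewrite (twist_sub _ tx) ?scale0r ?mem0v // => a Aa ea.
by rewrite ev_rtrans (elimT (mem_perp _ _) Wc) // WA // memv_proj.
Qed.

(** As [W n] is 0, b lies in level n of the twisted filtration. A twist element not killing b moves
    it one level down, and level 0 is zero. *)
Lemma twist_invariant r n (V : B -> Prop) b : W n = 0%VS ->
  (forall x c, V c -> V (ltrans x c)) -> V b -> b \in frobR hopfD cocoD p r -> b != 0 ->
  exists c, [/\ V c, c != 0 & forall x, twist r x -> ltrans x c = 0].
Proof.
move=> Wn Vlt Vb Rb nzb.
have: b \in frobv p r (perp hopfD cocoD (W n)).
  move: Rb; apply: subvP; apply: frobv_sub => // w _; apply: mem_frobv => //.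
  by apply/mem_perp => x; rewrite Wn memv0 => /eqP->; rewrite ev0r.
elim: n b Vb nzb {Rb Wn} => [|n IHn] b Vb nzb Wb.
  case/eqP: nzb; move: b Wb {Vb}; apply: frobv_ind => // [a u v -> ->|w Ww].
    by rewrite scaler0 addr0.
  have -> : w = 0.
    by apply: ev_inj => x; rewrite ev0l; apply: (elimT (mem_perp _ _) Ww); rewrite W0 memvf.
  by rewrite expr0n eqn0Ngt (pexp_gt0 pK).
have [[x [tx nz]] | no_x] := classic (exists x, twist r x /\ ltrans x b != 0).
  by apply: (IHn (ltrans x b)) => //; [apply: Vlt | apply: twist_filtration].
exists b; split=> // x tx; apply/eqP; apply: contra_notT no_x => nz.
by exists x.
Qed.

End Invariants.
End FrobeniusStep.

(** * Twisted invariants are p-th powers *)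

Section FrobeniusDescent.
Variables (K : fieldType) (H : falgType K).
Local Notation d := (\dim (fullv : {vspace H})).
Variables (D : 'Hom(H, 'M[K]_(d, d))) (e : 'Hom(H, K^o)) (S : 'End(H)).
Hypotheses (hopfD : is_hopf D e S) (cocoD : cocommutative D).
Local Notation h_ := (@hb K H).
Local Notation B := (cdual (hopf_cocoalg hopfD cocoD)).
Implicit Types (x y z : H) (b c : B) (W : {vspace B}).
Variable p : nat.
Hypothesis pK : p \in [pchar K].
Variables (A : {vspace H}) (N : {vspace B}).
Hypothesis A1 : 1 \in A.
Hypothesis NA : (perp hopfD cocoD A <= N * N)%VS.
Hypothesis NK : (N <= kerv hopfD cocoD)%VS.

Local Notation kerv := (kerv hopfD cocoD).
Local Notation R r := (frobR hopfD cocoD p r).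

(** A tangent vector g at the identity gives an invariant derivation: the value at x becomes a value
    at g after a left translation, which preserves Q. *)
Lemma rtrans_derivation (Q : {vspace B}) g b c :
  (forall x b, b \in Q -> ltrans x b \in Q) ->
  (forall b c, b \in Q -> c \in Q -> ev (b * c) g = ev b 1 * ev c g + ev b g * ev c 1) ->
  b \in Q -> c \in Q -> rtrans g (b * c) = rtrans g b * c + b * rtrans g c.
Proof.
move=> ltQ gQ Qb Qc; apply: ev_inj => x.
rewrite ev_rtrans -ev_ltrans ltransM ev_sum2 evDl !evM -big_split; apply: eq_bigr => i _.
rewrite -big_split; apply: eq_bigr => j _ /=.
rewrite gQ ?ltQ // !ev_ltrans !mulr1 !ev_hb !ffunE -mulrDr addrC.
by congr (_ * (_ + _)).
Qed.

(** An invariant b satisfies b(x) = (b translated by x)(1) = 0 on the twist, so double orthogonality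
    puts it in k1 plus the q-th powers of A^perp; b(1) = 0 removes the constant. *)
Lemma twisted_invariants_sub r b :
  b \in R r -> (forall x, twist hopfD cocoD p A r x -> ltrans x b = 0) ->
  ev b 1 = 0 -> b \in frobv p r (perp hopfD cocoD A).
Proof.
move=> Rb bI b1.
have : b \in (<[1]> + frobv p r (perp hopfD cocoD A))%VS.
  apply: sepB => x xP; rewrite -[x]mulr1 -ev_ltrans bI ?ev0l //; split=> [|c Ic].
    by rewrite -(ev1l hopfD cocoD) xP // (subvP (addvSl _ _)) ?memv_line.
  by rewrite xP // (subvP (addvSr _ _)).
case/memv_addP=> _ /vlineP[k ->] [c Ic bE]; move: b1.
have /eqP c1 : ev c 1 == 0 by rewrite -mem_kerv; exact: frobI_kerv Ic.
by rewrite bE evDl evZl ev11 c1 mulr1 addr0 => ->; rewrite scale0r add0r.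
Qed.

Lemma twisted_invariants_frob r b :
  b \in R r -> (forall x, twist hopfD cocoD p A r x -> ltrans x b = 0) -> b \in R r.+1.
Proof.
pose Dp b := b \in R r /\ forall x, twist hopfD cocoD p A r x -> ltrans x b = 0.
suff DR c : Dp c -> c \in R r.+1 by move=> Rb bI; apply: DR.
clear b.
pose m := (R r :&: kerv)%VS; pose m1 := (R r.+1 :&: kerv)%VS.
pose L := (R r * m1)%VS.
have RrM u v : u \in R r -> v \in R r -> u * v \in R r.
  by move=> Ru Rv; apply: (subvP (frobRM _ _ pK r)); apply: memv_mul.
have Dlin k u v : Dp u -> Dp v -> Dp (k *: u + v).
  case=> Ru uI [Rv vI]; split; first by rewrite memvD ?memvZ.
  by move=> x tx; rewrite linearP /= uI // vI // scaler0 addr0.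
have D1 : Dp 1.
  split; first exact: frobR1.
  move=> x [ex _]; apply: ev_inj => y; rewrite ev_ltrans ev0l ev1l (counitM hopfD) ex.
  exact: mul0r.
have Drt g u : Dp u -> Dp (rtrans g u).
  case=> Ru uI; split; first exact: frobR_rtrans.
  by move=> x tx; rewrite ltrans_rtrans uI // linear0.
have Dm u : Dp u -> ev u 1 = 0 -> u \in (m * m)%VS.
  case=> Ru uI u1; have := twisted_invariants_sub Ru uI u1.
  apply: subvP; apply: (@subv_trans _ _ (frobv p r (N * N)%VS)).
    by apply: frobv_sub => // w /(subvP NA); apply: mem_frobv.
  apply: subv_trans (frobvM pK _ _ _) _; apply: prodvS; apply: frobv_sub => // w Nw;
    by rewrite memv_cap mem_frobv ?memvf // frob_kerv // (subvP NK).
pose X := (m :\: (m * m))%VS.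
have mR u : u \in m -> u \in R r by rewrite memv_cap => /andP[].
have mK u : u \in m -> ev u 1 = 0 by rewrite memv_cap mem_kerv => /andP[_ /eqP].
have mmK u : u \in (m * m)%VS -> ev u 1 = 0.
  by move: u; apply: prodv_ind => [|k u v|u v /mK u1 _];
    rewrite ?ev0l // ?evM1 ?u1 ?mul0r // evPl => -> ->; rewrite mulr0 addr0.
(* A functional vanishing on Y, that is on m^2 and on 1, is a tangent vector of R at the identity; X
   complements m^2 in m and provides the coordinates. *)
pose Y : {vspace B} := (m * m + <[1%R]>)%VS.
have XY : (X :&: Y = 0)%VS.
  apply/eqP; rewrite -subv0; apply/subvP=> u; rewrite memv_cap => /andP[Xu].
  case/memv_addP=> v mv [_ /vlineP[k ->] uE].
  have k0 : k = 0.
    have := mK _ (subvP (diffvSl _ _) _ Xu).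
    by rewrite uE evDl evZl ev11 mmK // add0r mulr1.
  by rewrite -(capv_diff m (m * m)%VS) memv_cap Xu uE k0 scale0r addr0.
(* The [g i] vanish on Y and restrict on X to the basis dual to x. *)
have /fin_all_exists[g gP] (i : 'I_(\dim X)) : exists g,
    forall u, coord (vbasis X) i (daddv_pi X Y u) = ev u g.
  exact: (evl_surj (coord (vbasis X) i \o daddv_pi X Y : {linear B -> K^o})).
pose x (i : 'I_(\dim X)) : B := (vbasis X)`_i.
have gY i u : u \in Y -> ev u (g i) = 0.
  move=> Yu; have E : daddv_pi X Y u = 0.
    have YX : (Y :&: X = 0)%VS by rewrite capvC.
    have := daddv_pi_add XY (subvP (addvSr X Y) _ Yu).
    by rewrite (daddv_pi_id YX Yu) => /(canRL (addrK _)); rewrite subrr.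
  by rewrite -gP E linear0.
have gx i j : ev (x j) (g i) = (i == j)%:R.
  have Xx : x j \in X by apply/vbasis_mem/mem_nth; rewrite size_tuple.
  rewrite -gP daddv_pi_id // coord_free ?(basis_free (vbasisP X)) //.
  by rewrite eq_sym.
have gM i u v : u \in R r -> v \in R r ->
    ev (u * v) (g i) = ev u 1 * ev v (g i) + ev u (g i) * ev v 1.
  move=> Ru Rv; pose u0 := u - ev u 1 *: 1; pose v0 := v - ev v 1 *: 1.
  have mem0 w : w \in R r -> w - ev w 1 *: 1 \in m.
    move=> Rw; rewrite memv_cap memvB ?memvZ ?frobR1 //= mem_kerv.
    by rewrite evBl evZl ev11 mulr1 subrr.
  have g1 : ev (1 : B) (g i) = 0.
    by apply: gY; rewrite (subvP (addvSr _ _)) ?memv_line.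
  have uE : u = u0 + ev u 1 *: 1 by rewrite subrK.
  have vE : v = v0 + ev v 1 *: 1 by rewrite subrK.
  have g0 (w : B) : ev (w - ev w 1 *: 1) (g i) = ev w (g i).
    by rewrite evBl evZl g1 mulr0 subr0.
  have -> : u * v = u0 * v0 + ev v 1 *: u0 + (ev u 1 *: v0 + ev v 1 *: (ev u 1 *: 1)).
    have E (k l : K) (w z : B) :
        (w + k *: 1) * (z + l *: 1) = w * z + l *: w + (k *: z + l *: (k *: 1)).
      by rewrite mulrDl !mulrDr -!scalerAr -!scalerAl !mulr1 mul1r.
    by rewrite -E -uE -vE.
  have uv0 : ev (u0 * v0) (g i) = 0.
    by apply: gY; rewrite (subvP (addvSl _ _)) // memv_mul ?mem0.
  rewrite !evDl !evZl g1 /u0 /v0 !g0 -/u0 -/v0 uv0 add0r !mulr0 addr0 addrC.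
  by rewrite [ev v 1 * _]mulrC.
pose dl i : {linear B -> B} := rtrans (g i).
have dlM i u v : u \in R r -> v \in R r -> dl i (u * v) = dl i u * v + u * dl i v.
  by apply: rtrans_derivation => [y w|]; [exact: frobR_ltrans | exact: gM].
have dl1 i : dl i 1 = 0.
  have /eqP := dlM i _ _ (frobR1 hopfD cocoD pK r) (frobR1 hopfD cocoD pK r).
  by rewrite !mulr1 mul1r addrC -subr_eq subrr eq_sym => /eqP.
have dlX i u n : u \in R r -> dl i (u ^+ n.+1) = n.+1%:R *: (u ^+ n * dl i u).
  move=> Ru; have RX k : u ^+ k \in R r.
    by elim: k => [|k IH]; rewrite ?expr0 ?frobR1 // exprS RrM.
  elim: n => [|n IH]; first by rewrite expr1 scale1r mul1r.
  rewrite exprS dlM ?RX // IH -scalerAr mulrA -exprS mulrC [in RHS]mulrSr scalerDl.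
  by rewrite scale1r addrC.
(* Derivations kill p-th powers, so [dl i] is linear over [R r.+1] and preserves L. *)
have dl0 i u : u \in R r.+1 -> dl i u = 0.
  move: u; apply: frobv_ind => [|k u v du dv|u _]; first exact: linear0.
    by rewrite linearP /= du dv scaler0 addr0.
  rewrite expnSr exprM; set w := u ^+ _.
  have Rw : w \in R r by rewrite mem_frobv ?memvf.
  have := dlX i w p.-1 Rw; rewrite prednK ?prime_gt0 ?(pcharf_prime pK) // => ->.
  by rewrite (pcharf0 pK) scale0r.
(* The invariants vanishing at 1 are stable under [dl i]: right translations commute with left ones,
   and [g i] kills m^2, where these invariants lie. *)
have DL u : Dp u -> ev u 1 = 0 -> u \in L.
  move=> Du u1.
  apply: (@diff_closed_sub_frob K _ _ p (R r) m L pK _ _ _ _ _ _ _ x dl _ _ _ _ _ _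
     (fun u => Dp u /\ ev u 1 = 0)).
  - exact: frobR1.
  - exact: capvSl.
  - exact: frobRM.
  - apply/prodvP=> v w Rv mw; rewrite memv_cap (RrM _ _ Rv (mR _ mw)) /=.
    by rewrite mem_kerv evM1 (mK w) ?mulr0.
  - by rewrite /L prodvA prodvSl ?frobRM.
  - move=> y my; rewrite -[y ^+ p]mul1r memv_mul ?frobR1 // memv_cap.
    have := my; rewrite memv_cap => /andP[Ry Ky].
    by have := frob_kerv pK 1 Ky; have := frobvS pK 1 Ry; rewrite addn1 expn1 => -> ->.
  - by move=> i; apply/(subvP (diffvSl _ _))/vbasis_mem/mem_nth; rewrite size_tuple.
  - have -> : (<<codom x>> + m * m = X + m * m)%VS.
      congr (_ + _)%VS; rewrite -[RHS](span_basis (vbasisP X)); apply: eq_span => z.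
      apply/codomP/(nthP 0) => [[i ->]|[i]]; first by exists i; rewrite ?size_tuple.
      by rewrite size_tuple => lti <-; exists (Ordinal lti).
    by rewrite addv_diff addvSl.
  - by move=> i y; apply: frobR_rtrans.
  - move=> i; apply: linear_prodv_sub => v w Rv; rewrite memv_cap => /andP[Rw Kw].
    have Rw' : w \in R r by apply: subvP Rw; rewrite -addn1; apply: frobR_le.
    rewrite dlM // (dl0 _ w) // mulr0 addr0 memv_mul ?memv_cap ?Rw //.
    exact: frobR_rtrans.
  - by [].
  - move=> i j; have Rx : x j \in R r.
      by apply/mR/(subvP (diffvSl _ _))/vbasis_mem/mem_nth; rewrite size_tuple.
    have Rd : dl i (x j) \in R r by apply: frobR_rtrans.
    have -> : (i == j)%:R = (i == j)%:R *: 1 :> B by rewrite scaler_nat.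
    rewrite memv_cap memvB ?memvZ ?frobR1 //= mem_kerv evBl evZl ev11 mulr1.
    by rewrite ev_rtrans mul1r gx subrr.
  - by move=> y [Dy y1]; apply: Dm.
  - move=> i y [Dy y1]; split; first exact: Drt.
    by rewrite ev_rtrans mul1r gY // (subvP (addvSl _ _)) ?Dm.
  - by [].
have [t [Rt nzt tK]] := subalg_socle (frobR1 hopfD cocoD pK r.+1) (frobRM hopfD cocoD pK r.+1).
have tL u : u \in L -> t * u = 0.
  move: u; apply: prodv_ind => [|k u v tu tv|u v Ru]; first exact: mulr0.
    by rewrite mulrDr -scalerAr tu tv scaler0 addr0.
  rewrite memv_cap mem_kerv => /andP[Rv /eqP v1].
  by rewrite mulrCA tK // mulr0.
(* The conductor of the invariants into [R r.+1]. It is translation stable by [rtrans_mul], and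
   contains t because t u = u(1) t for invariant u. *)
pose a c := c \in R r.+1 /\ forall u, Dp u -> c * u \in R r.+1.
have a1 : a 1.
  apply: (@hopf_ideal_unit _ _ _ _ _ hopfD cocoD (R r.+1) a _ _ _ _ _ _ _ t) => //.
  - by move=> y b; apply: frobR_ltrans.
  - by move=> b; apply: frobR_antip.
  - by move=> w [].
  - by split=> [|u _]; rewrite ?mul0r mem0v.
  - by move=> b w [Rb ab] [Rw aw]; split=> [|u Du]; rewrite ?mulrDl memvD ?ab ?aw.
  - move=> b w [Rb ab] Rw; split=> [|u Du].
      by apply: (subvP (frobRM _ _ pK _)); rewrite memv_mul.
    by rewrite mulrAC; apply: (subvP (frobRM _ _ pK _)); rewrite memv_mul ?ab.
  - move=> y b [Rb ab]; split=> [|u Du]; first exact: frobR_rtrans.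
    rewrite rtrans_mul; apply: memv_suml => i _; apply: memv_suml => j _.
    by rewrite memvZ ?frobR_rtrans ?ab //; apply: Drt.
  split=> // u Du.
  have -> : t * u = ev u 1 *: t + t * (- ev u 1 *: 1 + u).
    by rewrite mulrDr scaleNr mulrN -scalerAr mulr1 addrA subrr add0r.
  rewrite tL ?addr0 ?memvZ //; apply: DL; first exact: Dlin.
  by rewrite evPl ev11 mulr1 addNr.
by move=> Dc; rewrite -[c]mul1r; case: a1 => _; apply.
Qed.

End FrobeniusDescent.

(** * Maximal and minimal subspaces with a given property *)

Lemma ex_maxv (K : fieldType) (V : vectType K) (P : {vspace V} -> Prop) U0 :
  P U0 -> exists U, [/\ P U, (U0 <= U)%VS &
    forall W, P W -> (U <= W)%VS -> W = U].
Proof.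
have [n] := ubnP (\dim (fullv : {vspace V}) - \dim U0)%N.
elim: n U0 => // n IHn U0 le_n PU0.
have [[W [PW sUW nWU]] | noW] :=
    classic (exists W, [/\ P W, (U0 <= W)%VS & W <> U0]); last first.
  exists U0; split=> // W PW sUW; apply: NNPP => nWU.
  by apply: noW; exists W.
have lt_dim : (\dim U0 < \dim W)%N.
  rewrite ltn_neqAle (dimvS sUW) andbT; apply/eqP => E; apply: nWU; apply/esym/eqP.
  by rewrite eqEdim sUW E leqnn.
have [|U [PU sWU maxU]] := IHn W _ PW.
  rewrite ltnS in le_n; apply: leq_trans le_n; apply: ltn_sub2l => //.
  exact: leq_trans lt_dim (dimvS (subvf _)).
by exists U; split=> //; apply: subv_trans sWU.
Qed.

Lemma ex_minv (K : fieldType) (V : vectType K) (P : {vspace V} -> Prop) U0 :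
  P U0 -> exists U, [/\ P U, (U <= U0)%VS &
    forall W, P W -> (W <= U)%VS -> W = U].
Proof.
have [n] := ubnP (\dim U0); elim: n U0 => // n IHn U0 le_n PU0.
have [[W [PW sWU nWU]] | noW] :=
    classic (exists W, [/\ P W, (W <= U0)%VS & W <> U0]); last first.
  exists U0; split=> // W PW sUW; apply: NNPP => nWU.
  by apply: noW; exists W.
have lt_dim : (\dim W < \dim U0)%N.
  rewrite ltn_neqAle (dimvS sWU) andbT; apply/eqP => E; apply: nWU; apply/eqP.
  by rewrite eqEdim sWU E leqnn.
have [|U [PU sUW minU]] := IHn W _ PW; first by rewrite ltnS in le_n; apply: leq_trans lt_dim le_n.
by exists U; split=> //; apply: subv_trans sWU.
Qed.

(** * Local augmented algebras *)

Section LocalAlgebra.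
Variables (K : fieldType) (H : falgType K) (e : 'Hom(H, K^o)).
Hypothesis e1 : e 1 = 1.
Hypothesis eM : forall x y, e (x * y) = e x * e y.

Section Subalgebra.
Variable A : {vspace H}.
Hypothesis A1 : 1 \in A.
Hypothesis AA : (A * A <= A)%VS.

Definition aug : {vspace H} := (A :&: lker e)%VS.

Lemma mem_aug x : (x \in aug) = (x \in A) && (e x == 0).
Proof. by rewrite memv_cap memv_ker. Qed.

Lemma aug_neq : aug != A.
Proof.
apply: contraTneq A1 => <-; rewrite mem_aug A1 e1; exact: oner_neq0.
Qed.

Lemma aug_left_ideal : left_ideal A aug.
Proof.
split; first exact: capvSl.
apply/prodvP=> a x Aa; rewrite !mem_aug => /andP[Ax /eqP ex].
by rewrite (subvP AA) ?memv_mul //= eM ex mulr0.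
Qed.

Lemma aug_right : (aug * A <= aug)%VS.
Proof.
apply/prodvP=> x a; rewrite !mem_aug => /andP[Ax /eqP ex] Aa.
by rewrite (subvP AA) ?memv_mul //= eM ex mul0r.
Qed.

(** If e(j) is nonzero for some j in J, every a in A is (e(a)/e(j)) j modulo [aug], so J would be
    A. *)
Lemma sub_aug J : left_ideal A J -> J != A -> (aug <= J)%VS -> J = aug.
Proof.
case=> sJA AJ nJA sJ; apply/eqP; rewrite eqEsubv sJ andbT.
apply/subvP=> j Jj; rewrite mem_aug (subvP sJA) //=; apply: contraR nJA => ej.
rewrite eqEsubv sJA; apply/subvP=> a Aa.
rewrite -[a](subrK ((e a / e j) *: j)) memvD ?memvZ //; apply: (subvP sJ).
have Aj := subvP sJA _ Jj; rewrite mem_aug memvB ?memvZ //= linearB linearZ /=.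
by rewrite -[(e a / e j) *: _]/((e a / e j) * e j) divfK // subrr.
Qed.

Lemma aug_maximal : maximal_left_ideal A aug.
Proof.
by split; [exact: aug_left_ideal | exact: aug_neq | exact: sub_aug].
Qed.

(** [aug] is always a maximal left ideal, and every proper left ideal lies in a maximal one. *)
Lemma localP : is_local A <->
  forall J, left_ideal A J -> J != A -> (J <= aug)%VS.
Proof.
split=> [[I [_ uniqI]] J idJ nJA | allJ].
  have [M [[idM nMA] sJM maxM]] :=
    @ex_maxv _ _ (fun J => left_ideal A J /\ J != A) J (conj idJ nJA).
  have MmaxM : maximal_left_ideal A M.
    by split=> // W idW nWA sMW; apply: maxM.
  by rewrite -(uniqI _ aug_maximal) (uniqI _ MmaxM).
exists aug; split; first exact: aug_maximal.
move=> M [idM nMA maxM]; apply: maxM (allJ _ idM nMA).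
  exact: aug_left_ideal.
exact: aug_neq.
Qed.

(** Let Y be a maximal proper submodule of U and w outside Y. If [aug] w were not in Y, then w = y +
    z w with z in [aug], and 1 - z would lie in the proper left ideal of all a with a w in Y, hence
    in [aug]. So [aug] w lies in Y, U = Y + A w, and [aug] U lies in Y. *)
Lemma nakayama U : is_local A -> (A * U <= U)%VS -> U != 0%VS -> (aug * U != U)%VS.
Proof.
move/localP=> locA AU nzU.
pose P (Y : {vspace H}) := [/\ (A * Y <= Y)%VS, (Y <= U)%VS & Y != U].
have P0 : P 0%VS by split; rewrite ?prodv0 ?sub0v // eq_sym.
have [Y [[AY sYU nYU] _ maxY]] := ex_maxv P0.
have [w Uw nYw] : exists2 w, w \in U & w \notin Y.
  by apply/subvPn; apply: contra nYU => sUY; rewrite eqEsubv sYU.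
have augA : (A * aug <= aug)%VS by case: aug_left_ideal.
have sAw Z : (Z <= A)%VS -> (Z * <[w]> <= U)%VS.
  by move=> sZA; apply: subv_trans AU; apply: prodvS.
have stabY Z : (Z <= A)%VS -> (A * Z <= Z)%VS -> (Y + Z * <[w]>)%VS != U ->
    (Z * <[w]> <= Y)%VS.
  move=> sZA AZ nU; rewrite -[X in (_ <= X)%VS](maxY (Y + Z * <[w]>)%VS) ?addvSl ?addvSr //.
  split=> //; last by rewrite subv_add sYU sAw.
  by rewrite prodvDr addvS // prodvA prodvSl.
have aw : (aug * <[w]> <= Y)%VS.
  apply: stabY => //; first exact: capvSl.
  apply: contraNneq nYw => UE.
  have: w \in (Y + aug * <[w]>)%VS by rewrite UE.
  case/memv_addP=> y Yy [v augv wE].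
  have [z augz vE] : exists2 z, z \in aug & v = z * w.
    move: v augv {wE}; apply: prodv_ind => [|k u v [z1 z1a ->] [z2 z2a ->]|z u za].
    - by exists 0; rewrite ?mem0v ?mul0r.
    - by exists (k *: z1 + z2); rewrite ?memvD ?memvZ // mulrDl scalerAl.
    by case/vlineP=> k ->; exists (k *: z); rewrite ?memvZ // -scalerAl scalerAr.
  pose J := (A :&: (linfun (w \o* idfun : H -> H) @^-1: Y))%VS.
  have memJ a : (a \in J) = (a \in A) && (a * w \in Y).
    by rewrite memv_cap -memv_preim lfunE.
  have JA : left_ideal A J.
    split; first exact: capvSl.
    apply/prodvP=> a x Aa; rewrite !memJ => /andP[Ax Yx].
    rewrite (subvP AA) ?memv_mul //= -mulrA; apply: (subvP AY).
    exact: memv_mul.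
  have [JE | nJA] := eqVneq J A.
    by move: A1; rewrite -JE memJ mul1r => /andP[].
  have zA : z \in A by move: augz; rewrite mem_aug => /andP[].
  have : 1 - z \in J by rewrite memJ memvB //= mulrBl mul1r -vE {1}wE addrK.
  move/(subvP (locA _ JA nJA)); rewrite mem_aug linearB /= e1.
  move: augz; rewrite mem_aug => /andP[_ /eqP->].
  by rewrite subr0 oner_eq0 andbF.
have YwU : (Y + A * <[w]> = U)%VS.
  apply/eqP; apply: contraNT nYw => nU.
  apply: (subvP (stabY A (subvv _) AA nU)).
  by rewrite -[w in w \in _]mul1r memv_mul ?memv_line.
apply: contraNneq nYU => augU; rewrite eqEsubv sYU -{1}augU -{1}YwU.
rewrite prodvDr subv_add prodvA (subv_trans (prodvSl _ aug_right)) // andbT.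
by apply: subv_trans AY; apply: prodvSl; apply: capvSl.
Qed.

(** The chain starts at H rather than at A, since the action of A^+ on all of H is what filters
    B. *)
Fixpoint aug_chain i : {vspace H} :=
  if i is j.+1 then (aug * aug_chain j)%VS else fullv.

Lemma aug_chain_stable i : (A * aug_chain i <= aug_chain i)%VS.
Proof.
case: i => [|i] /=; first exact: subvf.
by rewrite prodvA prodvSl //; case: aug_left_ideal.
Qed.

(** By [nakayama] the dimension drops at every step until the chain is zero. *)
Lemma aug_chain_nilpotent : is_local A -> exists n, aug_chain n = 0%VS.
Proof.
move=> locA; have P i : aug_chain i = 0%VS \/
    (\dim (aug_chain i) + i <= \dim (fullv : {vspace H}))%N.
  elim: i => [|i [E | le_i]]; first by right; rewrite addn0.
    by left; rewrite /= E prodv0.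
  have [E | nz] := eqVneq (aug_chain i) 0%VS; first by left; rewrite /= E prodv0.
  right; rewrite addnS; apply: leq_trans le_i; rewrite -addSn leq_add2r /=.
  have sub : (aug * aug_chain i <= aug_chain i)%VS.
    by apply: subv_trans (aug_chain_stable i); apply: prodvSl; apply: capvSl.
  rewrite ltn_neqAle dimvS // andbT; apply: contra (nakayama locA (aug_chain_stable i) nz).
  by move/eqP=> E; rewrite eqEdim sub E leqnn.
exists (\dim (fullv : {vspace H})).+1.
by have [//|] := P (\dim (fullv : {vspace H})).+1; rewrite addnS ltnNge leq_addl.
Qed.

End Subalgebra.

(** The augmentation ideal of H is nilpotent. If j in J has e(j) nonzero, then z = 1 - j/e(j) is
    nilpotent and every 1 - z^i lies in J, so J contains 1. *)
Lemma local_subalgebra (A : {vspace H}) : 1 \in A -> (A * A <= A)%VS ->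
  is_local (fullv : {vspace H}) -> is_local A.
Proof.
move=> A1 AA loc; apply/localP => // J [sJA AJ] nJA.
have [n Wn] := aug_chain_nilpotent (memvf _) (subvf _) loc.
apply/subvP=> j Jj; rewrite mem_aug (subvP sJA) //=; apply: contraR nJA => ej.
pose z := 1 - (e j)^-1 *: j.
have Az : z \in A by rewrite memvB ?memvZ // (subvP sJA).
have ez : e z = 0.
  rewrite linearB linearZ /= e1 -[_ *: _]/((e j)^-1 * e j).
  by rewrite mulVf // subrr.
have zJ i : 1 - z ^+ i \in J.
  elim: i => [|i IH]; first by rewrite subrr mem0v.
  have -> : 1 - z ^+ i.+1 = (1 - z ^+ i) + z ^+ i * ((e j)^-1 *: j).
    by rewrite exprSr {2}/z mulrBr mulr1 opprB addrA addrAC.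
  rewrite memvD //; apply: (subvP AJ); rewrite memv_mul ?memvZ //.
  elim: i {IH} => [|i IH]; rewrite ?expr0 // exprS.
  by rewrite (subvP AA) ?memv_mul.
have zW i : z ^+ i \in aug_chain fullv i.
  elim: i => [|i IH]; first exact: memvf.
  by rewrite exprS memv_mul // mem_aug memvf ez eqxx.
have := zJ n; have := zW n; rewrite Wn memv0 => /eqP->; rewrite subr0 => J1.
rewrite eqEsubv sJA; apply/subvP=> a Aa; rewrite -[a]mulr1.
by apply: (subvP AJ); rewrite memv_mul.
Qed.

End LocalAlgebra.

(** In a rank factorization M = C R, the equation M^2 = 0 forces R C = 0, and tr(C R) = tr(R C). *)
Lemma sqr_zero_trace (K : fieldType) n (M : 'M[K]_n) : M *m M = 0 -> \tr M = 0.
Proof.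
rewrite -{1 2 3}(mulmx_base M) => E.
suff E0 : row_base M *m col_base M = 0 by rewrite mxtrace_mulC E0 mxtrace0.
apply: (row_full_inj (col_base_full M)); apply: (row_free_inj (row_base_free M)).
by rewrite mulmx0 mul0mx -E !mulmxA.
Qed.

(** * The trace form *)

Section TraceForm.
Variables (K : fieldType) (H : falgType K).
Local Notation d := (\dim (fullv : {vspace H})).
Variables (D : 'Hom(H, 'M[K]_(d, d))) (e : 'Hom(H, K^o)) (S : 'End(H)).
Hypotheses (hopfD : is_hopf D e S) (cocoD : cocommutative D).
Local Notation h_ := (@hb K H).
Local Notation B := (cdual (hopf_cocoalg hopfD cocoD)).
Local Notation dlt := (delta hopfD cocoD).
Implicit Types (x y z : H) (b c : B).

(** Row convention in the basis [delta], so composites are products in reverse order. Taking bare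
    functions allows composites of translations and multiplications to be written directly. *)
Let mxof_fun (f : B -> B) : 'M[K]_d := \matrix_(i, j) f (dlt i) j.

Lemma mxof_fun_comp (f g : B -> B) : linear g -> mxof_fun (g \o f) = mxof_fun f *m mxof_fun g.
Proof.
move=> glin; pose G : {linear B -> B} := HB.pack g (GRing.isLinear.Build K B B _ g glin).
apply/matrixP=> i j; rewrite !mxE /= -[g _]/(G _) {1}[f _](cdual_expand (f (dlt i))).
rewrite linear_sum sum_ffunE; apply: eq_bigr => k _.
by rewrite linearZ /= ffunE !mxE.
Qed.

Let tau b : K := \tr (mxof_fun ( *%R b)).

Lemma tauE b : tau b = \sum_i (b * dlt i) i.
Proof. by apply: eq_bigr => i _; rewrite mxE. Qed.

(** [rtrans_mul] writes multiplication by x . b as a sum of x_1 . (b (S(x_2) . -)). Cyclicity of the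
    trace brings S(x_2) x_1 together, which collapses to e(x) by cocommutativity. *)
Lemma tau_rtrans x b : tau (rtrans x b) = e x * tau b.
Proof.
have Llin c : linear ( *%R c : B -> B).
  by move=> a u v; rewrite mulrDr scalerAr.
have Rlin y : linear (rtrans y : B -> B) by move=> a u v; rewrite linearP.
have E y z : \tr (mxof_fun (rtrans y \o ( *%R b \o rtrans z))) = \tr (mxof_fun (rtrans (z * y) \o *%R b)).
  rewrite (mxof_fun_comp _ (Rlin y)) (mxof_fun_comp _ (Llin b)) -mulmxA mxtrace_mulC.
  rewrite (mxof_fun_comp _ (Rlin (z * y))) -mulmxA -(mxof_fun_comp _ (Rlin z)).
  congr (\tr (_ *m _)); apply/matrixP=> i j; rewrite !mxE /=.
  by rewrite rtrans_comp.
transitivity (\sum_i \sum_j D x i j * \tr (mxof_fun (rtrans (S (h_ j) * h_ i) \o *%R b))).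
  under [RHS]eq_bigr => i _ do under eq_bigr => j _ do rewrite -E.
  rewrite tauE (eq_bigr (fun k => \sum_i \sum_j
      (D x i j *: rtrans (h_ i) (b * rtrans (S (h_ j)) (dlt k))) k)); last first.
    move=> k _; rewrite rtrans_mul sum_ffunE.
    by apply: eq_bigr => i _; rewrite sum_ffunE.
  rewrite exchange_big; apply: eq_bigr => i _.
  rewrite exchange_big; apply: eq_bigr => j _.
  rewrite mulr_sumr; apply: eq_bigr => k _.
  by rewrite mxE ffunE.
have TE (y : H) : \tr (mxof_fun (rtrans y \o *%R b)) = \sum_k ev (b * dlt k) (h_ k * y).
  by apply: eq_bigr => k _; rewrite mxE /= ffunE.
under eq_bigr => i _ do under eq_bigr => j _ do rewrite TE mulr_sumr.
under eq_bigr => i _ do rewrite exchange_big.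
rewrite exchange_big tauE mulr_sumr; apply: eq_bigr => k _ /=.
rewrite exchange_big /=.
have -> : e x * (b * dlt k) k =
    (\sum_i \sum_j D x i j *: rtrans (S (h_ i) * h_ j) (b * dlt k)) k.
  by rewrite (antipl hopfD (rtransl (b * dlt k))) /= /rtransl rtrans1 [RHS]ffunE.
rewrite sum_ffunE.
apply: eq_bigr => i _; rewrite sum_ffunE; apply: eq_bigr => j _.
by rewrite ffunE comul_sym // /rtransl ffunE.
Qed.

(** It suffices to treat c^2 = 0. Then each c v has square zero, hence trace 0, and c lies in the
    radical of the trace form; were c nonzero, [hopf_ideal_unit] would put 1 there, although [tau 1]
    is d. *)
Lemma reduced_of_dim b n : d%:R != 0 :> K -> b ^+ n = 0 -> b = 0.
Proof.
move=> nzd; suff red2 c : c * c = 0 -> c = 0.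
  have redX k : b ^+ (2 ^ k) = 0 -> b = 0.
    elim: k => [|k IH]; first by rewrite expr1.
    by rewrite expnSr exprM expr2 => /red2.
  move=> bn; apply: (redX n).
  by rewrite -(subnK (ltnW (ltn_expl n (ltnSn 1)))) exprD bn mulr0.
move=> c2; apply/eqP; apply: contraR nzd => nzc.
pose rad u := forall v : B, tau (u * v) = 0.
have rad1 : rad 1.
  apply: (@hopf_ideal_unit _ _ _ _ _ hopfD cocoD fullv rad _ _ _ _ _ _ _ c) => //.
  - by move=> *; apply: memvf.
  - by move=> *; apply: memvf.
  - by move=> *; apply: memvf.
  - by move=> v; rewrite mul0r tauE big1 // => i _; rewrite mul0r ffunE.
  - move=> u w ru rw v; rewrite mulrDl tauE.
    under eq_bigr => i _ do rewrite mulrDl ffunE.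
    by rewrite big_split /= -!tauE ru rw addr0.
  - by move=> u w ru _ v; rewrite -mulrA ru.
  - move=> x u ru v; rewrite rtrans_mul tauE.
    under eq_bigr => k _ do (rewrite mulr_suml sum_ffunE;
      under eq_bigr => i _ do rewrite mulr_suml sum_ffunE).
    rewrite exchange_big big1 // => i _; rewrite exchange_big big1 // => j _ /=.
    under eq_bigr => k _ do rewrite -scalerAl ffunE.
    by rewrite -scaler_sumr -tauE tau_rtrans ru mulr0 scaler0.
  move=> v; apply: sqr_zero_trace; rewrite -mxof_fun_comp; last first.
    by move=> a u w; rewrite mulrDr scalerAr.
  apply/matrixP=> i j; rewrite mxE [RHS]mxE [LHS](_ : _ = (c * v * (c * v * dlt i)) j) //.
  by rewrite mulrA [c * v * (c * v)]mulrACA c2 !mul0r ffunE.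
have := rad1 1; rewrite mulr1 tauE.
under eq_bigr => i _ do rewrite mul1r ffunE eqxx.
by rewrite sumr_const card_ord => ->.
Qed.

End TraceForm.

(** * Reducedness of high Frobenius powers *)

Section FrobeniusReduced.
Variables (K : fieldType) (H : falgType K).
Local Notation d := (\dim (fullv : {vspace H})).
Variables (D : 'Hom(H, 'M[K]_(d, d))) (e : 'Hom(H, K^o)) (S : 'End(H)).
Hypotheses (hopfD : is_hopf D e S) (cocoD : cocommutative D).
Local Notation B := (cdual (hopf_cocoalg hopfD cocoD)).
Variables (p : nat) (pK : p \in [pchar K]).
Local Notation R r := (frobR hopfD cocoD p r).

Lemma frobR_stable : exists r, R r.+1 = R r.
Proof.
have [U [[r ->] _ minU]] := @ex_minv _ _ (fun U => exists r, U = R r) (R 0) (ex_intro _ 0%N erefl).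
exists r; apply: minU; first by exists r.+1.
by rewrite -addn1; apply: frobR_le.
Qed.

(** Once the chain is stationary, the p-th powers of a basis of [R r] span [R r], hence form a
    basis. So u^p = 0 forces the p-th powers of the coordinates of u to vanish. *)
Lemma frobR_reduced : exists r, forall (b : B) n, b \in R r -> b ^+ n = 0 -> b = 0.
Proof.
have [r Rr] := frobR_stable; exists r.
pose X := vbasis (R r).
have pX u : u \in R r -> u ^+ p \in R r.
  by move=> Ru; rewrite -Rr -addn1 -(expn1 p); apply: frobvS.
have spanXp : (R r <= <<[seq (u ^+ p)%R | u <- X]>>)%VS.
  rewrite -{1}Rr; apply: frobv_sub => // w _; rewrite expnSr exprM.
  have : w ^+ (p ^ r) \in <<X>>%VS by rewrite (span_basis (vbasisP _)) mem_frobv ?memvf.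
  rewrite -[X in _ -> _ ^+ X \in _]expn1; apply: frob_span => // u Xu.
  by rewrite expn1; apply/memv_span/(map_f (fun u => u ^+ p)).
have freeXp : free (map_tuple (fun u => u ^+ p) X).
  have: basis_of (R r) (map_tuple (fun u => u ^+ p) X); last exact: basis_free.
  by rewrite basisEdim spanXp /= size_map size_tuple.
have redp u : u \in R r -> u ^+ p = 0 -> u = 0.
  move=> Ru up; rewrite (coord_vbasis Ru) big1 // => i _.
  have -> : coord X i u = 0; last by rewrite scale0r.
  have p0 : (0 < p)%N by apply/prime_gt0/(pcharf_prime pK).
  apply/eqP; rewrite -[_ == 0]andTb -p0 -expf_eq0; apply/eqP.
  have /freeP FE := freeXp; apply: (FE (fun j => coord X j u ^+ p)).
  rewrite -[RHS]up {2}(coord_vbasis Ru) frob_sum; last first.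
    by rewrite -[p]expn1; apply: pexp_pchar.
  by apply: eq_bigr => j _; rewrite exprZn (nth_map 0) ?size_tuple.
move=> b n Rb bn; have [k le_k] : exists k, (n <= p ^ k)%N.
  by exists n; apply/ltnW/ltn_expl/prime_gt1/(pcharf_prime pK).
have {}bn : b ^+ (p ^ k) = 0 by rewrite -(subnK le_k) exprD bn mulr0.
elim: k b Rb bn {le_k} => [|k IH] b Rb; first by rewrite expr1.
by rewrite expnS exprM => bn; apply: redp => //; apply: IH => //; apply: pX.
Qed.

End FrobeniusReduced.

(** * The coradical and its orthogonal *)

Section Coradical.
Variables (K : fieldType) (H : falgType K).
Local Notation d := (\dim (fullv : {vspace H})).
Variables (D : 'Hom(H, 'M[K]_(d, d))) (e : 'Hom(H, K^o)) (S : 'End(H)).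
Hypotheses (hopfD : is_hopf D e S) (cocoD : cocommutative D).
Local Notation h_ := (@hb K H).
Local Notation B := (cdual (hopf_cocoalg hopfD cocoD)).
Implicit Types (x y z : H) (b c : B).

Lemma tensDl a x y z : tens (a *: x + y) z = a *: tens x z + tens y z.
Proof. by apply/matrixP=> i j; rewrite !mxE /hco linearP mulrDl -mulrA. Qed.

Lemma tensDr a x y z : tens z (a *: x + y) = a *: tens z x + tens z y.
Proof. by apply/matrixP=> i j; rewrite !mxE /hco linearP mulrDr mulrCA. Qed.

Definition tensl y x := tens x y.
Fact tensl_is_linear y : linear (tensl y).
Proof. by move=> a u v; apply: tensDl. Qed.
HB.instance Definition _ y :=
  GRing.isLinear.Build K H 'M[K]_(d, d) _ (tensl y) (tensl_is_linear y).
Fact tens_is_linear y : linear (tens y).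
Proof. by move=> a u v; apply: tensDr. Qed.
HB.instance Definition _ y :=
  GRing.isLinear.Build K H 'M[K]_(d, d) _ (tens y) (tens_is_linear y).

Lemma tens_mem (U V : {vspace H}) x y : x \in U -> y \in V -> tens x y \in tensv U V.
Proof.
move=> Ux; rewrite -{1}(span_basis (vbasisP V)); move: y.
apply: (@span_ind _ _ _ (fun y => tens x y \in tensv U V)) => [|a u v tu tv|y Vy].
- by rewrite linear0 mem0v.
- by rewrite linearP memvD ?memvZ.
move: Ux; rewrite -{1}(span_basis (vbasisP U)); move: x.
apply: (@span_ind _ _ _ (fun x => tens x y \in tensv U V)) => [|a u v tu tv|x Ux].
- by rewrite -[tens _ _]/(tensl y 0) linear0 mem0v.
- by rewrite tensDl memvD ?memvZ.
by apply: memv_span; apply/allpairsP; exists (x, y).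
Qed.

Lemma tens_expand (M : 'M[K]_(d, d)) : M = \sum_i \sum_j M i j *: tens (h_ i) (h_ j).
Proof.
apply/matrixP=> k l; rewrite summxE (bigD1 k) //= [X in _ + X]big1 ?addr0; last first.
  move=> i /negPf nik; rewrite summxE big1 // => j _.
  by rewrite !mxE hco_hb eq_sym nik mul0r mulr0.
rewrite summxE (bigD1 l) //= [X in _ + X]big1 ?addr0; last first.
  move=> j /negPf njl; rewrite !mxE !hco_hb [l == j]eq_sym njl.
  by rewrite !mulr0.
by rewrite !mxE !hco_hb !eqxx !mulr1.
Qed.

(* The transpose of multiplication by b. *)
Definition act b x : H := \sum_i \sum_j (D x i j * (b j : K)) *: h_ i.

Lemma ev_act c b x : ev c (act b x) = ev (c * b) x.
Proof.
rewrite evM /act.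
under eq_bigr => i _ do rewrite -scaler_suml.
rewrite ev_sumr; apply: eq_bigr => i _; rewrite ev_hb mulr_suml.
by apply: eq_bigr => j _; rewrite -mulrA [X in _ * X]mulrC.
Qed.

Lemma ev_sep x y : (forall b, ev b x = ev b y) -> x = y.
Proof.
move=> E; apply/eqP; rewrite -subr_eq0 -memv0; apply: (@sepH _ _ _ _ _ hopfD cocoD).
by move=> b _; rewrite evBr E subrr.
Qed.

Fact act_is_linear b : linear (act b).
Proof. by move=> a x y; apply: ev_sep => c; rewrite evPr !ev_act evPr. Qed.
HB.instance Definition _ b :=
  GRing.isLinear.Build K H H _ (act b) (act_is_linear b).

Lemma actM b c x : act (b * c) x = act b (act c x).
Proof. by apply: ev_sep => u; rewrite !ev_act mulrA. Qed.

(** Subcoalgebras are the B-submodules of H. For the converse, the rows and columns of [D x] are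
    images of x under the dual basis, so both tensor factors can be taken in C. *)
Lemma subcoalgebraP (C : {vspace H}) :
  subcoalgebra D C <-> forall b x, x \in C -> act b x \in C.
Proof.
split=> [subC b x Cx | stabC x Cx].
  pose sl (M : 'M[K]_(d, d)) : H := \sum_i \sum_j (M i j * (b j : K)) *: h_ i.
  have slin : linear sl.
    move=> a M N; rewrite /sl scaler_sumr -big_split; apply: eq_bigr => i _.
    rewrite scaler_sumr -big_split; apply: eq_bigr => j _ /=.
    by rewrite !mxE mulrDl scalerDl -mulrA scalerA.
  rewrite -[act b x]/(sl (D x)).
  have := subC x Cx; move: (D x).
  apply: (@span_ind _ _ _ (fun M => sl M \in C)) => [|a M N sM sN|M].
  - by rewrite /sl big1 ?mem0v // => i _; rewrite big1 // => j _; rewrite mxE mul0r scale0r.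
  - by rewrite slin memvD ?memvZ.
  case/allpairsP=> -[u v] /= [/vbasis_mem Cu /vbasis_mem Cv ->].
  have -> : sl (tens u v) = ev b v *: u.
    rewrite [in RHS](hb_expand u) scaler_sumr; apply: eq_bigr => i _.
    rewrite scalerA /ev mulr_suml scaler_suml; apply: eq_bigr => j _.
    by rewrite mxE -mulrA mulrC.
  exact: memvZ.
have rowC i : \sum_j D x i j *: h_ j \in C.
  have -> : \sum_j D x i j *: h_ j = act (delta hopfD cocoD i) x.
    apply: eq_bigr => j _; rewrite (bigD1 i) //= big1 ?addr0.
      by rewrite ffunE eqxx mulr1 comul_sym.
    by move=> k /negPf nki; rewrite ffunE eq_sym nki mulr0 scale0r.
  exact: stabC.
have colC j : \sum_i D x i j *: h_ i \in C.
  by have := rowC j; under eq_bigr => i _ do rewrite comul_sym //.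
pose P := projv C.
have -> : D x = \sum_j tens (\sum_i D x i j *: h_ i) (P (h_ j)).
  transitivity (\sum_i \sum_j D x i j *: tens (h_ i) (P (h_ j))); last first.
    rewrite exchange_big; apply: eq_bigr => j _ /=.
    rewrite -[RHS]/(tensl (P (h_ j)) _) linear_sum; apply: eq_bigr => i _.
    by rewrite [RHS]linearZ.
  rewrite [LHS]tens_expand; apply: eq_bigr => i _.
  transitivity (tens (h_ i) (P (\sum_j D x i j *: h_ j))).
    rewrite /P projv_id // linear_sum; apply: eq_bigr => j _.
    by rewrite linearZ.
  by rewrite !linear_sum; apply: eq_bigr => j _; rewrite !linearZ.
by apply: memv_suml => j _; apply: tens_mem => //; apply: memv_proj.
Qed.

(** With P the projection onto H0 and Q = 1 - P, D x is the sum of its images under P (x) 1, Q (x) P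
    and Q (x) Q. The entries of the last are values at x of products of two elements of H0^perp. *)
Lemma coradical_step_mem (H0 : {vspace H}) x :
  (forall b c, b \in perp hopfD cocoD H0 -> c \in perp hopfD cocoD H0 -> ev (b * c) x = 0) ->
  x \in coradical_step D H0.
Proof.
move=> xN; rewrite /coradical_step -memv_preim.
pose P := projv H0; pose Q := (\1 - P)%VF.
have PQ y : y = P y + Q y by rewrite !lfun_simp addrC subrK.
have tPQ y z : tens y z = tens (P y) z + tens (Q y) (P z) + tens (Q y) (Q z).
  rewrite {1}[y]PQ [LHS](linearD (tensl z)) -addrA; congr (_ + _).
  by rewrite /tensl {1}[z]PQ; apply: (linearD (tens (Q y))).
have Q0 : \sum_i \sum_j D x i j *: tens (Q (h_ i)) (Q (h_ j)) = 0.
  apply/matrixP=> k l; rewrite summxE [RHS]mxE.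
  pose n i : B := [ffun j => hco i (Q (h_ j))].
  have nN i : n i \in perp hopfD cocoD H0.
    by apply/mem_perp => y H0y; rewrite ev_coord !lfun_simp projv_id // subrr /hco linear0.
  rewrite -[RHS](xN _ _ (nN k) (nN l)) evM; apply: eq_bigr => i _.
  rewrite summxE; apply: eq_bigr => j _.
  by rewrite !mxE !ffunE.
rewrite [D x]tens_expand.
have -> : \sum_i \sum_j D x i j *: tens (h_ i) (h_ j) =
  \sum_i \sum_j D x i j *: tens (P (h_ i)) (h_ j) +
  \sum_i \sum_j D x i j *: tens (Q (h_ i)) (P (h_ j)).
  rewrite -[RHS]addr0 -[X in _ = _ + X]Q0 -!big_split; apply: eq_bigr => i _ /=.
  by rewrite -!big_split; apply: eq_bigr => j _; rewrite /= {1}tPQ !scalerDr.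
rewrite addrC; apply: memv_add; apply: memv_suml => i _; apply: memv_suml => j _;
  by rewrite memvZ ?tens_mem ?memvf ?memv_proj.
Qed.

(* If b is not nilpotent it acts bijectively on b^n H for some n, hence nontrivially on a
   simple subcoalgebra of H contained in b^n H. *)
Lemma coradical_perp_nilpotent (H0 : {vspace H}) b :
  is_coradical D H0 -> b \in perp hopfD cocoD H0 -> exists n, b ^+ n = 0.
Proof.
case=> simpleH0 _ bN; apply: NNPP => nilb.
pose F c := linfun (act c : {linear H -> H}).
have FE c x : F c x = act c x by rewrite lfunE.
have [W [[n ->] _ minW]] := @ex_minv _ _
  (fun U => exists n, U = limg (F (b ^+ n))) _ (ex_intro _ 0%N erefl).
set U := limg (F (b ^+ n)) in minW *.
have nzU : U != 0%VS.
  apply/eqP => U0; apply: nilb; exists n; apply: ev_inj => x.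
  rewrite ev0l -[b ^+ n]mul1r -ev_act -FE.
  by have := memv_img (F (b ^+ n)) (memvf x); rewrite -/U U0 memv0 => /eqP->; rewrite ev0r.
have stabU c x : x \in U -> act c x \in U.
  case/memv_imgP=> y _ ->; apply/memv_imgP; exists (act c y); first exact: memvf.
  by rewrite !FE -!actM mulrC.
have bU : (F b @: U)%VS = U.
  apply: minW.
    exists n.+1; rewrite -limg_comp; congr (lfun_img _ _); apply/lfunP => x.
    by rewrite comp_lfunE !FE -actM -exprS.
  by apply/subvP=> _ /memv_imgP[y Uy ->]; rewrite FE; apply: stabU.
have kerU : (U :&: lker (F b) = 0)%VS.
  apply/eqP; rewrite -dimv_eq0 -(eqn_add2r (\dim (F b @: U))%VS) limg_ker_dim.
  by rewrite add0n bU.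
have [C [[stabC nzC] sCU minC]] := @ex_minv _ _ (fun C : {vspace H} =>
  (forall c x, x \in C -> act c x \in C) /\ C != 0%VS) U (conj stabU nzU).
have CH0 : (C <= H0)%VS.
  apply: simpleH0; split=> //; first exact/subcoalgebraP.
  move=> C' /subcoalgebraP stabC' sC'.
  by have [-> | nz] := eqVneq C' 0%VS; [left | right; apply: minC].
case/eqP: nzC; apply/eqP; rewrite -subv0 -kerU subv_cap sCU.
apply/subvP=> x Cx; rewrite memv_ker FE; apply/eqP/ev_sep => c.
rewrite ev0r ev_act mulrC -ev_act; apply: (elimT (mem_perp _ _) bN).
by rewrite (subvP CH0) ?stabC.
Qed.

End Coradical.

(** * Constants in translation invariant subspaces of B *)

Section UnitInSubmodules.
Variables (K : fieldType) (H : falgType K).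
Local Notation d := (\dim (fullv : {vspace H})).
Variables (D : 'Hom(H, 'M[K]_(d, d))) (e : 'Hom(H, K^o)) (S : 'End(H)).
Hypotheses (hopfD : is_hopf D e S) (cocoD : cocommutative D).
Local Notation B := (cdual (hopf_cocoalg hopfD cocoD)).
Variables (A : {vspace H}) (N : {vspace B}).
Hypotheses (A1 : 1 \in A) (AA : (A * A <= A)%VS) (locA : is_local A).
Hypothesis NA : (perp hopfD cocoD A <= N * N)%VS.
Hypothesis Nnil : forall b, b \in N -> exists n, b ^+ n = 0.

Lemma submodule_unit p (V : B -> Prop) b : p \in [pchar K] ->
  (forall x c, V c -> V (ltrans x c)) -> V b -> b != 0 ->
  exists2 k, k != 0 & V (k *: 1).
Proof.
move=> pK Vlt Vb nzb.
have NK : (N <= kerv hopfD cocoD)%VS.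
  apply/subvP=> c /Nnil[n cn]; rewrite mem_kerv.
  have := evX1 c n; rewrite cn ev0l => /esym/eqP.
  by rewrite expf_eq0 => /andP[].
have p_pr := pcharf_prime pK.
have [n Wn] := aug_chain_nilpotent (counit1 hopfD) (counitM hopfD) A1 AA locA.
have WA i x y : x \in A -> e x = 0 -> y \in aug_chain e A i -> x * y \in aug_chain e A i.+1.
  by move=> Ax ex Wy; rewrite memv_mul // mem_aug Ax ex eqxx.
have inv r c : V c -> c \in frobR hopfD cocoD p r -> c != 0 ->
    exists c, [/\ V c /\ c \in frobR hopfD cocoD p r, c != 0 &
      forall x, twist hopfD cocoD p A r x -> ltrans x c = 0].
  move=> Vc Rc nzc.
  apply: (twist_invariant (V := fun c => V c /\ c \in frobR hopfD cocoD p r)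
    pK A1 (erefl _) WA Wn) nzc => // x u [Vu Ru].
  by split; [apply: Vlt | apply: frobR_ltrans].
(* Taking twisted invariants inside V at level r lands in level r + 1. *)
have VR r : exists c, [/\ V c, c \in frobR hopfD cocoD p r & c != 0].
  elim: r => [|r [c [Vc Rc nzc]]].
    by exists b; split=> //; rewrite -[b]expr1 -(expn0 p) mem_frobv ?memvf.
  have [u [[Vu Ru] nzu uI]] := inv r c Vc Rc nzc.
  by exists u; split=> //; apply: (twisted_invariants_frob pK A1 NA NK).
have [r red] := frobR_reduced hopfD cocoD pK.
have [c [Vc Rc nzc]] := VR r.
have {c Vc Rc nzc} [c [[Vc Rc] nzc cI]] := inv r c Vc Rc nzc.
(* The nilpotency exponent is taken to be a power of p, so that sums are handled by Frobenius. *)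
have nilA u : u \in perp hopfD cocoD A -> exists s, u ^+ (p ^ s) = 0.
  move/(subvP NA); move: u; apply: prodv_ind => [|k u v [s us] [t vt]|u v Nu _].
  - by exists 0%N; rewrite expr1.
  - have u0 : u ^+ (p ^ (s + t)) = 0.
      by rewrite expnD exprM us expr0n eqn0Ngt (pexp_gt0 pK).
    have v0 : v ^+ (p ^ (s + t)) = 0.
      by rewrite addnC expnD exprM vt expr0n eqn0Ngt (pexp_gt0 pK).
    by exists (s + t)%N; rewrite exprDn_pchar ?pexp_pchar // exprZn u0 v0 scaler0 addr0.
  have [m um] := Nnil Nu; exists m; rewrite exprMn.
  have le_m : (m <= p ^ m)%N by apply/ltnW/ltn_expl/prime_gt1.
  by rewrite -(subnK le_m) exprD um mulr0 mul0r.
(* At a reduced level the q-th powers of A^perp vanish, so the twist is all of ker e. *)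
have tw x : e x = 0 -> twist hopfD cocoD p A r x.
  move=> ex; split=> // u; move: u.
  apply: frobv_ind => [|k u v ux vx|u /nilA[s us]]; first exact: ev0l.
    by rewrite evPl ux vx mulr0 addr0.
  rewrite (red (u ^+ (p ^ r)) (p ^ s)%N) ?ev0l ?mem_frobv ?memvf //.
  by rewrite -exprM mulnC exprM us expr0n eqn0Ngt (pexp_gt0 pK).
(* Invariance under x - e(x) 1 gives c(x) = e(x) c(1). *)
have cE : c = ev c 1 *: 1.
  apply: ev_inj => x; rewrite evZl ev1l.
  have ex : e (x - (e x : K) *: 1) = 0.
    by rewrite -!(ev1l hopfD cocoD) evBr evZr ev11 mulr1 subrr.
  have := cI _ (tw _ ex) => /(congr1 (fun u : B => ev u 1)).
  by rewrite ev_ltrans mulr1 ev0l evBr evZr mulrC => /subr0_eq.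
exists (ev c 1); last by rewrite -cE.
by apply: contraNneq nzc => c1; rewrite cE c1 scale0r.
Qed.

End UnitInSubmodules.

(** * Locality of H and of the subalgebra generated by H_1 *)

Theorem theoremA (K : fieldType) (H : falgType K)
    (D : 'Hom(H, 'M[K]_(\dim (fullv : {vspace H}), \dim (fullv : {vspace H}))))
    (e : 'Hom(H, K^o)) (S : 'End(H)) (H0 : {vspace H}) :
  is_hopf D e S -> cocommutative D -> is_coradical D H0 ->
  (is_local (fullv : {vspace H}) <-> is_local (agenv (coradical_step D H0))).
Proof.
move=> hopfD cocoD corad; set A := agenv _.
have A1 : 1 \in A by rewrite memvE; apply: sub1_agenv.
have AA : (A * A <= A)%VS by rewrite /A agenvM.
have He1 := counit1 hopfD; have HeM := counitM hopfD.
split; first exact: (local_subalgebra He1 HeM).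
move=> locA; pose N := perp hopfD cocoD H0.
have Nnil b : b \in N -> exists n, b ^+ n = 0 by apply: coradical_perp_nilpotent.
(* An element of H killed by all products of two elements of N lies in H_1, hence in A; double
   orthogonality turns this into the inclusion. *)
have NA : (perp hopfD cocoD A <= N * N)%VS.
  apply/subvP=> b bA; apply: sepB => x xN; apply: (elimT (mem_perp _ _) bA).
  apply: (subvP (sub_agenv _)); apply: (coradical_step_mem (hopfD := hopfD) (cocoD := cocoD)).
  by move=> u v Nu Nv; apply: xN; apply: memv_mul.
have [nzd | ] := boolP ((\dim (fullv : {vspace H}))%:R != 0 :> K).
  suff <- : A = fullv by [].
  apply/eqP; rewrite eqEsubv subvf; apply/subvP=> x _.
  apply: (@sepH _ _ _ _ _ hopfD cocoD) => b /(subvP NA) NNb.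
  suff -> : b = 0 by apply: ev0l.
  apply/eqP; rewrite -memv0; apply: subvP NNb; apply/prodvP=> u v /Nnil[n un] _.
  by rewrite (reduced_of_dim nzd un) mul0r mem0v.
(* The positive integer d vanishes in K, so K has prime characteristic. *)
rewrite negbK => /natf0_pchar-[|p pK].
  by rewrite lt0n dimv_eq0; apply/eqP => f0; have := memvf (1 : H);
    rewrite f0 memv0 oner_eq0.
apply/(localP He1 HeM (memvf _) (subvf _)) => U [_ stabU] nU.
(* V is U^perp. The unit of B is e, so a nonzero multiple of it in V means that e vanishes on U. *)
pose V (b : cdual (hopf_cocoalg hopfD cocoD)) := forall u, u \in U -> ev b u = 0.
have Vlt x c : V c -> V (ltrans x c).
  by move=> Vc u Uu; rewrite ev_ltrans Vc // (subvP stabU) // memv_mul ?memvf.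
have [b Vb nzb] : exists2 b, V b & b != 0.
  apply: NNPP => noV; case/negP: nU; rewrite eqEsubv subvf; apply/subvP=> x _.
  apply: (@sepH _ _ _ _ _ hopfD cocoD) => b /mem_perp Vb.
  have [-> | nz] := eqVneq b 0; first exact: ev0l.
  by case: noV; exists b.
have [k nzk Vk] := submodule_unit A1 AA locA NA Nnil pK Vlt Vb nzb.
apply/subvP=> u Uu; rewrite mem_aug memvf /=.
have /eqP := Vk u Uu; rewrite evZl ev1l mulf_eq0 (negPf nzk).
by [].
Qed.
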